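(* Let $V'\subset\mathbb{R}^2$ be the point set generated by the dual substitution $\sigma'$ from the seed $V_0'$, that is, the set of positions of all typed points in $\bigcup_{k\ge 1}(\sigma')^k(V_0')$, where $\sigma'$ and $V_0'$ are as defined in the context. Then $V'$ is a (regular) model set. That is, there exist an integer $e\ge 1$, a lattice $\Lambda\subset\mathbb{R}^{2+e}$ of full rank, projections $\pi_1:\mathbb{R}^{2+e}\to\mathbb{R}^2$ and $\pi_2:\mathbb{R}^{2+e}\to\mathbb{R}^e$ such that $\pi_1|_\Lambda$ is injective and $\pi_2(\Lambda)$ is dense in $\mathbb{R}^e$, and a nonempty compact set $W\subset\mathbb{R}^e$ with $\mathrm{cl}(\mathrm{int}(W))=W$ and $\mu(\partial W)=0$, such that, with $$U:=\{\pi_1(\boldsymbol{x}) : \boldsymbol{x}\in\Lambda,\ \pi_2(\boldsymbol{x})\in W\},$$ one has $V'\subseteq U$ and $\mathrm{dens}(V')=\mathrm{dens}(U)$.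
   Context: **Notation.** $\mathrm{cl}$, $\mathrm{int}$, $\partial$ denote closure, interior and boundary. $\mu$ is Lebesgue measure in the dimension at hand, and $\mathbb{B}^d$ is the closed unit ball of $\mathbb{R}^d$ with the Euclidean norm. For a point set $X\subset\mathbb{R}^d$, $\mathrm{dens}(X)=\lim_{r\to\infty}\frac{\#(X\cap r\mathbb{B}^d)}{\mu(r\mathbb{B}^d)}$ (an equality of densities includes the existence of both limits). ''Projections'' $\pi_1,\pi_2$ are the canonical linear projections belonging to the splitting $\mathbb{R}^{d+e}=\mathbb{R}^d\times\mathbb{R}^e$ (here $d=2$), where the order in which the coordinates are assigned to the two factors is immaterial. **Model sets.** A set $V\subset\mathbb{R}^d$ is regarded as a (regular) model set if there is a cut-and-project scheme $(\Lambda,\pi_1,\pi_2)$ (lattice $\Lambda$ of full rank in $\mathbb{R}^{d+e}$, $\pi_1|_\Lambda$ injective, $\pi_2(\Lambda)$ dense in $\mathbb{R}^e$) and a window $W$ (nonempty, compact, $\mathrm{cl}(\mathrm{int}(W))=W$, $\mu(\partial W)=0$) such that $V$ is the set $U=\{\pi_1(\boldsymbol{x}) : \boldsymbol{x}\in\Lambda,\ \pi_2(\boldsymbol{x})\in W\}$, where the identification is understood in the sense that $V\subseteq U$ and $\mathrm{dens}(V)=\mathrm{dens}(U)$. **Constants.** Let $s_k=\sin(k\pi/9)$ and $$\lambda=\frac{s_4}{s_1},\qquad \lambda_2=-\frac{s_1}{s_2},\qquad \lambda_3=\frac{s_2}{s_4},$$ which are the three roots of $x^3-3x^2+1$. Put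 $$u=(1,1)^T,\quad g=(\lambda_2,\lambda_3)^T,\quad b=(\lambda_2^2,\lambda_3^2)^T,\quad Q=\begin{pmatrix}\lambda_2&0\\0&\lambda_3\end{pmatrix},\quad Q'=Q^{-1}.$$ **Prototiles and dual substitution.** Let $(W_L,W_M,W_S)$ be the unique triple of nonempty compact subsets of $\mathbb{R}^2$ such that, with $W_\ast=W_L\cup W_M\cup W_S$, $$W_L=QW_\ast\cup(QW_L-b+g),\qquad W_M=QW_\ast-g,\qquad W_S=QW_M-b+g.$$ The dual substitution $\sigma'$ on translates of the prototiles is given by $$\sigma'(\{W_L\})=\{W_L,\ W_M,\ W_S,\ W_L-g+u\},$$ $$\sigma'(\{W_M\})=\{W_L-u,\ W_M-u,\ W_S-u\},$$ $$\sigma'(\{W_S\})=\{W_M-g+u\},$$ together with $\sigma'(\{W_i+t\})=\sigma'(\{W_i\})+Q't$ for $t\in\mathbb{R}^2$ and $i\in\{L,M,S\}$; it is extended to collections of tiles by taking unions. **Control points and $\sigma'$ on points.** The control points are $c_L=0$, $c_M=Qc_L-g=-g$, $c_S=Qc_M-b+g=g-2b$. A tile $W_i+t$ is represented by the typed point of type $i$ at position $c_i+t$, and $\sigma'$ acts on typed points by transport of the tile rule. Explicitly, $\sigma'$ maps - a point of type $L$ at position $p$ to: type $L$ at $Q'p$, type $M$ at $Q'p-g$, type $S$ at $Q'p+g-2b$, type $L$ at $Q'p-g+u$; - a point of type $M$ at position $p$ to: type $L$ at $Q'p$, type $M$ at $Q'p-g$, type $S$ at $Q'p+g-2b$; - a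 point of type $S$ at position $p$ to: type $M$ at $Q'p$; and it maps a set of typed points to the union of the images of its elements. **Seed.** $V_0'$ consists of the two typed points: type $L$ at $c_L=0$, and type $M$ at $c_M-b+2g+u=g-b+u$. One has $V_0'\subset\sigma'(V_0')$, so the sets $(\sigma')^k(V_0')$ are increasing in $k$. *)

(* Defs.v *)
From HB Require Import structures.
From mathcomp Require Import all_boot all_order all_algebra.
From mathcomp Require Import all_classical all_reals all_analysis.

Set Implicit Arguments.
Unset Strict Implicit.
Unset Printing Implicit Defensive.

Import Order.TTheory GRing.Theory Num.Theory.
Import numFieldNormedType.Exports.

Local Open Scope classical_set_scope.
Local Open Scope ring_scope.

Section ModelSets.
Context {R : realType}.
Implicit Types n d e : nat.

(* The library norm on 'rV[R]_n is the sup norm, which induces the same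
   topology; the Euclidean norm is needed for the averaging balls. *)
Definition enorm n (x : 'rV[R]_n) : R := Num.sqrt (\sum_i x 0 i ^+ 2).

Definition eball n (r : R) : set 'rV[R]_n := [set x | enorm x <= r].

Definition box n (a b : 'rV[R]_n) : set 'rV[R]_n :=
  [set x | forall i, a 0 i <= x 0 i <= b 0 i].

(* n-dimensional Lebesgue (outer) measure, as the infimum of the total volumes
   of countable covers by closed boxes. It is used only for n >= 1 and on
   closed sets, where it is the Lebesgue measure. Boxes may be degenerate, so
   for n >= 1 finite covers are included. *)
Definition lebesgue n (A : set 'rV[R]_n) : \bar R :=
  ereal_inf [set s | exists a b : nat -> 'rV[R]_n,
    [/\ forall k i, a k 0 i <= b k 0 i,
        A `<=` \bigcup_k box (a k) (b k) &
        s = (\sum_(0 <= k <oo) (\prod_i (b k 0 i - a k 0 i))%:E)%E]].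

Definition boundary n (A : set 'rV[R]_n) : set 'rV[R]_n :=
  closure A `\` interior A.

Definition has_density d (X : set 'rV[R]_d) (delta : R) : Prop :=
  (counting (X `&` eball r) / lebesgue (@eball d r))%E @[r --> +oo%R]
    --> delta%:E.

(* The integer row combinations of a basis, the rows of B. *)
Definition full_rank_lattice n (Lambda : set 'rV[R]_n) : Prop :=
  exists2 B : 'M[R]_n, B \in unitmx &
    Lambda = [set map_mx intr z *m B | z in [set: 'rV[int]_n]].

Definition proj1 d e (x : 'rV[R]_(d + e)) : 'rV[R]_d := lsubmx x.
Definition proj2 d e (x : 'rV[R]_(d + e)) : 'rV[R]_e := rsubmx x.

Definition cut_and_project_scheme d e (Lambda : set 'rV[R]_(d + e)) : Prop :=
  [/\ full_rank_lattice Lambda,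
      set_inj Lambda (@proj1 d e) &
      dense (@proj2 d e @` Lambda)].

Definition window e (W : set 'rV[R]_e) : Prop :=
  [/\ W !=set0, compact W, closure (interior W) = W &
      lebesgue (boundary W) = 0%E].

Definition cut_and_project_set d e (Lambda : set 'rV[R]_(d + e))
    (W : set 'rV[R]_e) : set 'rV[R]_d :=
  [set proj1 x | x in [set x | Lambda x /\ W (proj2 x)]].

(* V is a model set up to a set of density zero: it is contained in a
   cut-and-project set of the same density (both limits existing). *)
Definition regular_model_set d (V : set 'rV[R]_d) : Prop :=
  exists (e : nat) (Lambda : set 'rV[R]_(d + e)) (W : set 'rV[R]_e),
    [/\ (1 <= e)%N, cut_and_project_scheme Lambda, window W,
        V `<=` cut_and_project_set Lambda W &
        exists delta : R, has_density V delta /\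
                          has_density (cut_and_project_set Lambda W) delta].

End ModelSets.

Section DualSubstitution.
Variable R : realType.
Notation plane := 'rV[R]_2.

Definition s_ (k : nat) : R := sin (k%:R * pi / 9).

Definition lambda2 : R := - (s_ 1 / s_ 2).
Definition lambda3 : R := s_ 2 / s_ 4.

Definition vec2 (x y : R) : plane := \row_j (if j == 0 then x else y).

Definition u : plane := vec2 1 1.
Definition g : plane := vec2 lambda2 lambda3.
Definition b : plane := vec2 (lambda2 ^+ 2) (lambda3 ^+ 2).

(* Matrices act on row vectors from the right; Q is diagonal. *)
Definition Q : 'M[R]_2 := diag_mx (vec2 lambda2 lambda3).
Definition Q' : 'M[R]_2 := invmx Q.

Inductive tile_type := tL | tM | tS.

Definition typed_point : Type := tile_type * plane.

Definition dual_point (q : typed_point) : set typed_point :=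
  let: (i, p) := q in
  let p' : plane := p *m Q' in
  match i with
  | tL => [set (tL, p'); (tM, p' - g); (tS, p' + g - b *+ 2); (tL, p' - g + u)]
  | tM => [set (tL, p'); (tM, p' - g); (tS, p' + g - b *+ 2)]
  | tS => [set (tM, p')]
  end.

Definition dual_substitution (X : set typed_point) : set typed_point :=
  \bigcup_(q in X) dual_point q.

Definition c_L : plane := 0.
Definition c_M : plane := c_L *m Q - g.

Definition dual_seed : set typed_point :=
  [set (tL, c_L); (tM, c_M - b + g *+ 2 + u)].

Definition dual_point_set : set plane :=
  [set p | exists k i,
     (1 <= k)%N /\ iter k dual_substitution dual_seed (i, p)].

End DualSubstitution.

Arguments dual_point_set R : clear implicits.

(* Main.v *)
Require Import Defs.
From HB Require Import structures.
From mathcomp Require Import all_boot all_order all_algebra.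
From mathcomp Require Import all_classical all_reals all_analysis.
From mathcomp Require Import zify ring lra.

Set Implicit Arguments.
Unset Strict Implicit.
Unset Printing Implicit Defensive.

Import Order.TTheory GRing.Theory Num.Theory.
Import numFieldNormedType.Exports.

Local Open Scope classical_set_scope.
Local Open Scope ring_scope.

(** Write a cubic integer as [a0 + a1 x + a2 x^2] with integer coefficients,
    modulo [x^3 - 3x^2 + 1]. Its values at the roots [lambda2] and [lambda3] are
    the coordinates of a point of the plane ([phys]); its value at the third
    root [lambda1 = 2.879...] is its [height]. The vectors [u], [g], [b] are the
    points of [1], [x], [x^2], and [Q'] divides by the root, so the dual
    substitution acts on typed cubic integers. On the plane it expands; on
    heights it acts by contractions [y -> y / lambda1 + const].

    The attractors of these contractions are intervals. If each interval is
    taken open on the left and closed on the right, the contractions map the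
    three typed intervals onto a partition of themselves ([children_window],
    [parent_exists]). Hence the heights of generated points never leave the
    intervals, and conversely every typed cubic integer with height in its
    interval has a parent of the same kind. Passing to parents contracts the
    plane by [Q], so after finitely many steps one lands in a fixed bounded box;
    only seven typed cubic integers have bounded conjugates and admissible
    height there, and all of them descend from the seed ([core_of_near],
    [core_generated]). So the generated set consists exactly of the points of
    the cubic integers whose height lies in the half-open windows
    ([generatedP], [dual_point_setE]). The cut-and-project set of the closed
    windows has just two further points ([cut_and_project_lattice_points]),
    because a cubic integer is determined by its height ([ceval_inj]).

    It remains to see that a density exists. Translating one component of the
    window by the height of a cubic integer makes the two components adjacent,
    and the merged half-open interval has length [lambda1^2 - 1], the height of
    [x^2 - 1]. Consequently it selects exactly one element from each coset of
    the integer multiples of [x^2 - 1] ([coset_rep_window],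
    [coset_rep_unique]). The cosets form a group of rank two, so the generated
    set is the image of a rank two lattice of the plane under a map that moves
    every point by a bounded amount ([parametrization_near]). For such a set the
    number [N r] of points in the ball of radius [r] satisfies
    [N (k r) <= k^2 N (r + C)], since dividing lattice indices by [k] is at most
    [k^2] to one; as for subadditive sequences, this forces [N r / r^2] to
    converge ([cvg_of_scaling]). The area of the ball is a positive multiple of
    [r^2], and two extra points do not change the limit. *)

(** * Integers of the cubic field *)

(** The triple of coefficients of [1], [x], [x^2]. *)
Definition cubic_int : Type := int * int * int.

Definition ceval (R : pzRingType) (x : R) (a : cubic_int) : R :=
  let: (a0, a1, a2) := a in a0%:~R + a1%:~R * x + a2%:~R * x ^+ 2.

(** The norm form: the determinant of the multiplication by
    [a0 + a1 x + a2 x^2] modulo [x^3 - 3x^2 + 1]. *)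
Definition cnorm (S : pzRingType) (a0 a1 a2 : S) : S :=
  a0 * (a0 * (a0 + 3 * a1 + 9 * a2) + a2 * (a1 + 3 * a2))
  + a2 * (a1 * (a0 + 3 * a1 + 9 * a2) + a2 * a2)
  - (a1 + 3 * a2) * (a1 * (a1 + 3 * a2) - a2 * a0).

Lemma cnorm_intr (S : comNzRingType) (a0 a1 a2 : int) :
  (cnorm a0 a1 a2)%:~R = cnorm (a0%:~R : S) a1%:~R a2%:~R.
Proof. by rewrite /cnorm; ring. Qed.

(** [x^3 - 3x^2 + 1] has no root modulo 2, so it is irreducible there and the
    norm form is anisotropic. *)
Lemma cnorm_F2 (x y z : 'F_2) : cnorm x y z = 0 -> [&& x == 0, y == 0 & z == 0].
Proof.
move/eqP; rewrite /cnorm; apply/implyP.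
by case: x => [[|[|//]] ?]; case: y => [[|[|//]] ?]; case: z => [[|[|//]] ?].
Qed.

(** Infinite descent: a zero of the norm form is divisible by 2. *)
Lemma cnorm_eq0 (a0 a1 a2 : int) :
  cnorm a0 a1 a2 = 0 -> [/\ a0 = 0, a1 = 0 & a2 = 0].
Proof.
have [n] := ubnP (`|a0| + `|a1| + `|a2|)%N.
elim: n a0 a1 a2 => // n IHn a0 a1 a2 le_an N0.
have F2_even (a : int) : a%:~R == 0 :> 'F_2 -> exists b, a = 2 * b.
  rewrite -(dvdz_pcharf (pchar_Fp _)) // => /dvdzP[b ->].
  by exists b; rewrite mulrC.
have /and3P[/F2_even[b0 a0E] /F2_even[b1 a1E] /F2_even[b2 a2E]] :
    [&& a0%:~R == 0 :> 'F_2, a1%:~R == 0 :> 'F_2 & a2%:~R == 0 :> 'F_2].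
  by apply: cnorm_F2; rewrite -cnorm_intr N0.
have N0b : cnorm b0 b1 b2 = 0.
  apply: (@mulfI _ 8) => //; rewrite mulr0 -[RHS]N0 a0E a1E a2E /cnorm; ring.
have [a_eq0|a_neq0] := eqVneq (`|a0| + `|a1| + `|a2|)%N 0%N; first by split; lia.
have [] := IHn b0 b1 b2 _ N0b; first by lia.
by rewrite a0E a1E a2E => -> -> ->.
Qed.

Section Algebra.
Variable R : realType.
Implicit Types (x y : R) (a c : cubic_int).

Definition is_cubic_root x := x ^+ 3 - 3 * x ^+ 2 + 1 = 0.

(** A value times the product of its two conjugates is the norm; the latter
    product is the value of the cubic integer with coefficients [c0 c1 c2]. *)
Lemma ceval_inj0 x a : is_cubic_root x -> ceval x a = 0 -> a = 0.
Proof.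
case: a => [[a0 a1] a2] /= rx; rewrite /is_cubic_root in rx => a_eq0.
suff : cnorm a0 a1 a2 = 0 by case/cnorm_eq0 => -> -> ->.
apply/eqP; rewrite -(intr_eq0 R); apply/eqP.
rewrite cnorm_intr /cnorm.
move: a0%:~R a1%:~R a2%:~R a_eq0 => {a0 a1 a2} a0 a1 a2 a_eq0.
pose c0 := a0 * (a0 + 3 * a1 + 9 * a2) + a2 * (a1 + 3 * a2).
pose c1 := - (a1 * (a0 + 3 * a1 + 9 * a2) + a2 * a2).
pose c2 := a1 * (a1 + 3 * a2) - a2 * a0.
have : (a0 + a1 * x + a2 * x ^+ 2) * (c0 + c1 * x + c2 * x ^+ 2) = 0.
  by rewrite a_eq0 mul0r.
have x3 : x ^+ 3 = 3 * x ^+ 2 - 1 by lra.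
have x4 : x ^+ 4 = 9 * x ^+ 2 - x - 3.
  have -> : x ^+ 4 = x * x ^+ 3 by ring.
  rewrite x3; have -> : x * (3 * x ^+ 2 - 1) = 3 * x ^+ 3 - x by ring.
  rewrite x3; ring.
have -> : (a0 + a1 * x + a2 * x ^+ 2) * (c0 + c1 * x + c2 * x ^+ 2) =
   a0 * c0 + (a0 * c1 + a1 * c0) * x + (a0 * c2 + a1 * c1 + a2 * c0) * x ^+ 2
   + (a1 * c2 + a2 * c1) * x ^+ 3 + a2 * c2 * x ^+ 4 by ring.
rewrite x3 x4 => <-; rewrite /c0 /c1 /c2; ring.
Qed.

Lemma cevalD x a c : ceval x (a + c) = ceval x a + ceval x c.
Proof. by case: a c => [[a0 a1] a2] [[c0 c1] c2] /=; rewrite !intrD; ring. Qed.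

Lemma cevalN x a : ceval x (- a) = - ceval x a.
Proof. by case: a => [[a0 a1] a2] /=; rewrite !intrN; ring. Qed.

Lemma cevalB x a c : ceval x (a - c) = ceval x a - ceval x c.
Proof. by rewrite cevalD cevalN. Qed.

Lemma ceval_inj x : is_cubic_root x -> injective (ceval x).
Proof.
move=> rx a c eq_ac; apply/eqP; rewrite -subr_eq0; apply/eqP.
by apply: (ceval_inj0 rx); rewrite cevalB eq_ac subrr.
Qed.

Definition mul_root a : cubic_int :=
  let: (a0, a1, a2) := a in (- a2, a0, a1 + 3 * a2).

Definition div_root a : cubic_int :=
  let: (a0, a1, a2) := a in (a1, a2 + 3 * a0, - a0).

Lemma ceval_mul_root x a : is_cubic_root x -> ceval x (mul_root a) = x * ceval x a.
Proof.
case: a => [[a0 a1] a2] /= rx; rewrite /is_cubic_root in rx.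
rewrite intrD intrM intrN.
have -> : x * (a0%:~R + a1%:~R * x + a2%:~R * x ^+ 2) =
  a0%:~R * x + a1%:~R * x ^+ 2 + a2%:~R * x ^+ 3 by ring.
have -> : x ^+ 3 = 3 * x ^+ 2 - 1 by lra.
by ring.
Qed.

End Algebra.

(** * The three roots *)

Section Constants.
Variable R : realType.
Local Notation l2 := (lambda2 R).
Local Notation l3 := (lambda3 R).
Implicit Types x : R.

Lemma cos_mulr3n x : cos (x *+ 3) = 4 * cos x ^+ 3 - 3 * cos x.
Proof.
rewrite mulrS cosD cos_mulr2n sin_mulr2n.
have := cos2Dsin2 x; set c := cos x; set s := sin x => cs1.
have -> : s * ((c * s) *+ 2) = 2 * c * s ^+ 2 by ring.
have -> : s ^+ 2 = 1 - c ^+ 2 by lra.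
by ring.
Qed.

(** [4 X^3 - 3 X + 1 = (X + 1) (2 X - 1)^2], and [cos (pi / 3)] is positive. *)
Lemma cos_pi3 : cos (pi / 3) = 1 / 2 :> R.
Proof.
have pi0 := pi_gt0 R.
have c0 : 0 < cos (pi / 3 : R) by apply: cos_gt0_pihalf; lra.
have : cos ((pi / 3) *+ 3) = -1 :> R.
  by rewrite -cospi; congr cos; rewrite -mulr_natr; field.
rewrite cos_mulr3n; set c := cos _ in c0 *.
move=> c3; have : (c + 1) * (2 * c - 1) ^+ 2 = 0.
  have -> : (c + 1) * (2 * c - 1) ^+ 2 = 4 * c ^+ 3 - 3 * c + 1 by ring.
  by rewrite c3; ring.
move/eqP; rewrite mulf_eq0 expf_eq0 /= => /orP[/eqP h|/eqP h]; lra.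
Qed.

Lemma sin_half_ratio x : 0 < sin x -> sin x / sin (x *+ 2) = (2 * cos x)^-1.
Proof.
move=> s0; rewrite sin_mulr2n -mulr_natr.
have [->|c0] := eqVneq (cos x) 0; first by rewrite !(mul0r, mulr0, invr0).
by field; rewrite c0 gt_eqF.
Qed.

Lemma lambda2E : l2 = - (2 * cos (pi / 9))^-1.
Proof.
have pi0 := pi_gt0 R.
rewrite /lambda2 /s_; congr (- _).
have -> : 2 * pi / 9 = (1 * pi / 9) *+ 2 :> R by rewrite -mulr_natr; field.
rewrite sin_half_ratio ?mul1r //.
by apply: sin_gt0_pi; lra.
Qed.

Lemma lambda3E : l3 = (2 * cos (2 * pi / 9))^-1.
Proof.
have pi0 := pi_gt0 R.
rewrite /lambda3 /s_.
have -> : 4 * pi / 9 = (2 * pi / 9) *+ 2 :> R by rewrite -mulr_natr; field.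
rewrite sin_half_ratio //.
by apply: sin_gt0_pi; lra.
Qed.

(** The reciprocal equation [x^3 - 3x + 1] is the one satisfied by the doubled
    cosines [2 cos (2 pi / 9)] and [- 2 cos (pi / 9)]. *)
Lemma is_cubic_rootV x : x != 0 -> x ^+ 3 - 3 * x + 1 = 0 -> is_cubic_root x^-1.
Proof.
move=> x0 hx; rewrite /is_cubic_root; apply: (mulfI (expf_neq0 3 x0)).
by rewrite mulr0 -[RHS]hx; field.
Qed.

Lemma lambda2_root : is_cubic_root l2.
Proof.
have pi0 := pi_gt0 R.
have c0 : 0 < cos (pi / 9 : R) by apply: cos_gt0_pihalf; lra.
rewrite lambda2E -invrN; apply: is_cubic_rootV; first by lra.
have : cos ((pi / 9) *+ 3) = 1 / 2 :> R.
  by rewrite -cos_pi3; congr cos; rewrite -mulr_natr; field.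
rewrite cos_mulr3n => h; set c := cos _ in h *.
have -> : (- (2 * c)) ^+ 3 - 3 * - (2 * c) + 1 = 1 - 2 * (4 * c ^+ 3 - 3 * c) by ring.
by rewrite h; field.
Qed.

Lemma cos_2pi9_gt : 1 / 2 < cos (2 * pi / 9) :> R.
Proof.
have pi0 := pi_gt0 R.
rewrite -cos_pi3 ltr_cos; first by lra.
all: by rewrite in_itv /=; lra.
Qed.

Lemma lambda3_root : is_cubic_root l3.
Proof.
have pi0 := pi_gt0 R.
have c0 := cos_2pi9_gt.
rewrite lambda3E; apply: is_cubic_rootV; first by lra.
have : cos ((2 * pi / 9) *+ 3) = - (1 / 2) :> R.
  rewrite -cos_pi3; have -> : (2 * pi / 9) *+ 3 = pi - pi / 3 :> R.
    by rewrite -mulr_natr; field.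
  by rewrite cosB cospi sinpi; ring.
rewrite cos_mulr3n => h; set c := cos _ in h *.
have -> : (2 * c) ^+ 3 - 3 * (2 * c) + 1 = 1 + 2 * (4 * c ^+ 3 - 3 * c) by ring.
by rewrite h; field.
Qed.

Lemma lambda2_bounds : - (58 / 109) < l2 < - (83 / 156).
Proof.
have pi0 := pi_gt0 R.
have c0 : 0 < cos (pi / 9 : R) by apply: cos_gt0_pihalf; lra.
have : l2 < 0 by rewrite lambda2E oppr_lt0 invr_gt0; lra.
have := lambda2_root; rewrite /is_cubic_root.
move: l2 => x rx x0; apply/andP; split; rewrite ltNge; apply/negP => hx; nra.
Qed.

Lemma lambda3_bounds : 62 / 95 < l3 < 47 / 72.
Proof.
have c0 := cos_2pi9_gt.
have : 0 < l3 < 1.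
  rewrite lambda3E invr_gt0 invf_lt1; lra.
have := lambda3_root; rewrite /is_cubic_root.
move: l3 => x rx /andP[x0 x1].
(* x^3 - 3x^2 + 1 decreases on [0, 1] *)
have mono (c d : R) : 0 <= c -> c <= d -> d <= 1 ->
    d ^+ 3 - 3 * d ^+ 2 + 1 <= c ^+ 3 - 3 * c ^+ 2 + 1.
  move=> c_ge0 cd d1; rewrite -subr_ge0.
  have -> : c ^+ 3 - 3 * c ^+ 2 + 1 - (d ^+ 3 - 3 * d ^+ 2 + 1) =
    (d - c) * (d * (1 - d) + c * (1 - c) + 2 * d + 2 * c - d * c) by ring.
  by apply: mulr_ge0; nra.
apply/andP; split; rewrite ltNge; apply/negP => hx.
  have := mono x (62 / 95); lra.
have := mono (47 / 72) x; lra.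
Qed.

(** The third root, obtained from the trace. *)
Definition lambda1 : R := 3 - l2 - l3.

Lemma lambda_sum2 : l2 ^+ 2 + l2 * l3 + l3 ^+ 2 = 3 * (l2 + l3).
Proof.
have /andP[_ h2] := lambda2_bounds; have /andP[h3 _] := lambda3_bounds.
have r2 := lambda2_root; have r3 := lambda3_root; rewrite /is_cubic_root in r2 r3.
apply: (@mulfI _ (l2 - l3)); first by lra.
have -> : (l2 - l3) * (l2 ^+ 2 + l2 * l3 + l3 ^+ 2) = l2 ^+ 3 - l3 ^+ 3 by ring.
have -> : (l2 - l3) * (3 * (l2 + l3)) = 3 * l2 ^+ 2 - 3 * l3 ^+ 2 by ring.
lra.
Qed.

Lemma lambda1_root : is_cubic_root lambda1.
Proof.
have s2 := lambda_sum2; have r2 := lambda2_root; rewrite /is_cubic_root in r2 *.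
rewrite /lambda1; set x := l2 in s2 r2 *; set y := l3 in s2 *.
have -> : (3 - x - y) ^+ 3 - 3 * (3 - x - y) ^+ 2 + 1 =
   (x ^+ 3 - 3 * x ^+ 2 + 1) +
   (3 - 2 * x - y) * (x ^+ 2 + x * y + y ^+ 2 - 3 * (x + y)) by ring.
by rewrite r2 s2; ring.
Qed.

Lemma lambda1_bounds : 429 / 149 < lambda1 < 239 / 83.
Proof. have := lambda2_bounds; have := lambda3_bounds; by rewrite /lambda1; lra. Qed.

Lemma sqr_bounds (x c d : R) : 0 <= c -> c < x < d -> c ^+ 2 < x ^+ 2 < d ^+ 2.
Proof.
move=> c0 /andP[cx xd]; rewrite !ltr_pXn2r ?nnegrE ?cx ?xd //; lra.
Qed.

Lemma lambda1_sq_bounds : 315 / 38 < lambda1 ^+ 2 < 199 / 24.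
Proof. have /(sqr_bounds _) := lambda1_bounds; lra. Qed.

Lemma lambda2_sq_bounds : 15 / 53 < l2 ^+ 2 < 17 / 60.
Proof.
have : 83 / 156 < - l2 < 58 / 109 by have := lambda2_bounds; lra.
by move/(sqr_bounds _); rewrite sqrrN; lra.
Qed.

Lemma lambda3_sq_bounds : 23 / 54 < l3 ^+ 2 < 26 / 61.
Proof. have /(sqr_bounds _) := lambda3_bounds; lra. Qed.

End Constants.

(** * The dual substitution on cubic integers *)

Section Dynamics.
Variable R : realType.
Local Notation l1 := (lambda1 R).
Local Notation l2 := (lambda2 R).
Local Notation l3 := (lambda3 R).
Implicit Types (a c : cubic_int) (t : tile_type).

(** The physical coordinates of a cubic integer; [height] below is its internal
    coordinate. *)
Definition phys a : 'rV[R]_2 := vec2 (ceval l2 a) (ceval l3 a).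
Definition height a : R := ceval l1 a.
Arguments height : simpl never.

Lemma vec2_0 (x y : R) : vec2 x y 0 0 = x.
Proof. by rewrite mxE. Qed.

Lemma vec2_1 (x y : R) : vec2 x y 0 1 = y.
Proof. by rewrite mxE. Qed.

Lemma physD a c : phys (a + c) = phys a + phys c.
Proof. by apply/rowP => i; rewrite !mxE !cevalD; case: ifP. Qed.

Lemma physN a : phys (- a) = - phys a.
Proof. by apply/rowP => i; rewrite !mxE !cevalN; case: ifP. Qed.

Lemma physB a c : phys (a - c) = phys a - phys c.
Proof. by rewrite physD physN. Qed.

Lemma uE : u R = phys (1, 0, 0).
Proof. by rewrite /phys /u; congr vec2; rewrite /= !(mul0r, addr0). Qed.

Lemma gE : g R = phys (0, 1, 0).
Proof.
by rewrite /phys /g; congr vec2; rewrite /= !(mul0r, addr0, add0r, mul1r).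
Qed.

Lemma bE : b R = phys (0, 0, 1).
Proof.
by rewrite /phys /b; congr vec2; rewrite /= !(mul0r, addr0, add0r, mul1r).
Qed.

Lemma lambda2_neq0 : l2 != 0.
Proof. have /andP[_ h] := lambda2_bounds R; apply: ltr0_neq0; lra. Qed.

Lemma lambda3_neq0 : l3 != 0.
Proof. have /andP[h _] := lambda3_bounds R; apply: lt0r_neq0; lra. Qed.

Lemma Q_unit : Q R \in unitmx.
Proof.
rewrite unitmxE det_diag unitfE; apply/prodf_neq0 => i _; rewrite mxE.
by case: ifP => _; rewrite ?lambda2_neq0 ?lambda3_neq0.
Qed.

Lemma div_rootK : cancel div_root mul_root.
Proof. by case=> [[a0 a1] a2] /=; congr (_, _, _); lia. Qed.

Lemma mul_rootK : cancel mul_root div_root.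
Proof. by case=> [[a0 a1] a2] /=; congr (_, _, _); lia. Qed.

Arguments mul_root : simpl never.
Arguments div_root : simpl never.

Lemma phys_mul_root a : phys (mul_root a) = phys a *m Q R.
Proof.
apply/rowP => i; rewrite mul_mx_diag !mxE.
by case: ifP => _; rewrite ceval_mul_root 1?mulrC //;
  [apply: lambda2_root|apply: lambda3_root].
Qed.

Lemma phys_div_root a : phys a *m Q' R = phys (div_root a).
Proof.
rewrite -{1}(div_rootK a) phys_mul_root -mulmxA /Q' mulmxV ?mulmx1 //.
exact: Q_unit.
Qed.

Lemma height_mul_root a : height (mul_root a) = l1 * height a.
Proof. by apply: ceval_mul_root; apply: lambda1_root. Qed.

(** The action of the substitution on typed cubic integers, see [dual_pointE]. *)
Definition children (q : tile_type * cubic_int) : seq (tile_type * cubic_int) :=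
  let: (t, a) := q in let c := div_root a in
  match t with
  | tL => [:: (tL, c); (tM, c - (0, 1, 0)); (tS, c + (0, 1, -2)); (tL, c + (1, -1, 0))]
  | tM => [:: (tL, c); (tM, c - (0, 1, 0)); (tS, c + (0, 1, -2))]
  | tS => [:: (tM, c)]
  end.

Definition embed (q : tile_type * cubic_int) : typed_point R := (q.1, phys q.2).

Lemma dual_pointE q :
  dual_point (embed q) =
  [set embed q' | q' in [set q' | List.In q' (children q)]].
Proof.
have pS (c : cubic_int) : phys c + g R - b R *+ 2 = phys (c + (0, 1, -2)).
  rewrite gE bE mulr2n -physD -physD -physB; congr phys.
  by case: c => [[c0 c1] c2]; congr (_, _, _); rewrite /=; lia.
have pL (c : cubic_int) : phys c - g R + u R = phys (c + (1, -1, 0)).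
  rewrite gE uE -physB -physD; congr phys.
  by case: c => [[c0 c1] c2]; congr (_, _, _); rewrite /=; lia.
case: q => t a; rewrite /embed /=.
apply/seteqP; split => [[t' p]|_ [[t' a'] /= + <-]]; case: t;
  rewrite /= phys_div_root.
- case=> [[[|]|]|] [-> ->].
  + by exists (tL, div_root a) => //=; left.
  + by exists (tM, div_root a - (0, 1, 0)); [right; left|rewrite /= physB gE].
  + by exists (tS, div_root a + (0, 1, -2)); [right; right; left|rewrite /= pS].
  + by exists (tL, div_root a + (1, -1, 0)); [do 3 right; left|rewrite /= pL].
- case=> [[|]|] [-> ->].
  + by exists (tL, div_root a) => //=; left.
  + by exists (tM, div_root a - (0, 1, 0)); [right; left|rewrite /= physB gE].
  + by exists (tS, div_root a + (0, 1, -2)); [right; right; left|rewrite /= pS].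
- by case=> -> ->; exists (tM, div_root a) => //=; left.
- case=> [|[|[|[|//]]]] [<- <-] /=; rewrite ?physB -?gE -?pS -?pL.
  + by do 3 left.
  + by left; left; right.
  + by left; right.
  + by right.
- case=> [|[|[|//]]] [<- <-] /=; rewrite ?physB -?gE -?pS.
  + by do 2 left.
  + by left; right.
  + by right.
- by case=> [[<- <-]|//].
Qed.

(** The three intervals solve the system of set equations for the heights.
    They are half-open so that the pieces on the right-hand sides are disjoint
    and cover them exactly. *)
Definition in_window (q : tile_type * cubic_int) : Prop :=
  let x := height q.2 in
  match q.1 with
  | tL => - l1 < x <= 0
  | tM => l1 - l1 ^+ 2 < x <= - l1
  | tS => 1 - 2 * l1 ^+ 2 < x <= l1 - 2 * l1 ^+ 2
  end.

Lemma l1_gt0 : 0 < l1.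
Proof. have /andP[h _] := lambda1_bounds R; lra. Qed.

Lemma heightD a c : height (a + c) = height a + height c.
Proof. exact: cevalD. Qed.

Lemma heightN a : height (- a) = - height a.
Proof. exact: cevalN. Qed.

Lemma height_lit (n0 n1 n2 : int) :
  height (n0, n1, n2) = n0%:~R + n1%:~R * l1 + n2%:~R * l1 ^+ 2.
Proof. by []. Qed.

(** The windows divided by [lambda1]; the identity
    [1 - 2 y^2 = y^2 - y^3] for [y = lambda1] puts the window of type [tS] in
    this form. *)
Definition scaled_window t (x : R) : bool :=
  match t with
  | tL => - 1 < x <= 0
  | tM => 1 - l1 < x <= - 1
  | tS => l1 - l1 ^+ 2 < x <= 1 - 2 * l1
  end.

Lemma in_window_mul_root t c :
  in_window (t, mul_root c) <-> scaled_window t (height c).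
Proof.
have r := lambda1_root R; rewrite /is_cubic_root in r.
have l0 := l1_gt0.
case: t; rewrite /in_window /= height_mul_root.
- have -> : - l1 = l1 * - 1 by ring.
  by rewrite ltr_pM2l // pmulr_rle0.
- have -> : l1 - l1 ^+ 2 = l1 * (1 - l1) by ring.
  have -> : - l1 = l1 * - 1 by ring.
  by rewrite ltr_pM2l // ler_pM2l.
- have -> : 1 - 2 * l1 ^+ 2 = l1 * (l1 - l1 ^+ 2) by lra.
  have -> : l1 - 2 * l1 ^+ 2 = l1 * (1 - 2 * l1) by ring.
  by rewrite ltr_pM2l // ler_pM2l.
Qed.

Lemma children_window q q' : in_window q -> List.In q' (children q) -> in_window q'.
Proof.
have r := lambda1_root R; rewrite /is_cubic_root in r.
have /andP[b1 b2] := lambda1_bounds R.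
have m2 : 1 + 2 * l1 < l1 ^+ 2 by nra.
have m3 : 3 * l1 - 1 < l1 ^+ 2 by nra.
case: q => t a; rewrite -{1}(div_rootK a) => /in_window_mul_root.
rewrite /= /in_window /=.
move: (div_root a) => c.
case: t => /= /andP[lo up];
  (do ?case) => // <- /=; rewrite ?heightD ?heightN ?height_lit; lra.
Qed.

Definition generated (q : tile_type * cubic_int) : Prop :=
  exists2 k, (1 <= k)%N & iter k (@dual_substitution R) (@dual_seed R) (embed q).

Lemma seedL : embed (tL, 0) = (tL, @c_L R).
Proof.
rewrite /embed /c_L; congr (_, _).
by apply/rowP => i; rewrite !mxE /=; case: ifP => _; rewrite /= ?mul0r ?addr0.
Qed.

Lemma seedM : embed (tM, (1, 1, -1)) = (tM, c_M R - b R + g R *+ 2 + u R).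
Proof.
rewrite /embed /c_M /c_L mul0mx mulr2n gE bE uE.
rewrite sub0r -!physN -!physD; congr (_, _).
Qed.

Lemma generated_child q q' : generated q -> List.In q' (children q) -> generated q'.
Proof.
move=> [k k1 gq] cq; exists k.+1 => //.
by rewrite iterS; exists (embed q) => //; rewrite dual_pointE; exists q'.
Qed.

Lemma generated_seed q :
  @dual_seed R (embed q) -> List.In q (children q) -> generated q.
Proof.
move=> sq cq; exists 1 => //.
by exists (embed q) => //; rewrite dual_pointE; exists q.
Qed.

(** The height of the second seed point, [1 + lambda1 - lambda1^2 = -4.41...],
    is the fixed point of the contraction [y -> y / lambda1 - lambda1]. *)
Lemma window_of_generated k p : iter k (@dual_substitution R) (@dual_seed R) p ->
  exists2 q, p = embed q & in_window q.
Proof.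
have r := lambda1_root R; rewrite /is_cubic_root in r.
have /andP[b1 b2] := lambda1_bounds R.
elim: k p => [p /= [] ->|k IHk p /=].
- exists (tL, 0); rewrite ?seedL // /in_window /= height_lit; lra.
- exists (tM, (1, 1, -1)); rewrite ?seedM // /in_window /= height_lit; nra.
- case=> p0 /IHk[q -> wq]; rewrite dual_pointE => -[q' /= cq' <-].
  by exists q' => //; apply: children_window wq cq'.
Qed.

(** The windows are covered by the images of the windows; the possible
    translations [s] are recorded because they control the position of the
    parent. *)
Lemma parent_exists q' : in_window q' ->
  exists (q : tile_type * cubic_int) s, [/\ in_window q, List.In q' (children q),
    q.2 = mul_root (q'.2 - s) & List.In s [:: 0; (1, -1, 0); (0, -1, 0); (0, 1, -2)]].
Proof.
have r := lambda1_root R; rewrite /is_cubic_root in r.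
have /andP[b1 b2] := lambda1_bounds R.
case: q' => t' a /= wa.
suff [t [s [ws chs sS]]] : exists t s,
    [/\ scaled_window t (height (a - s)),
      forall c, div_root c = a - s -> List.In (t', a) (children (t, c))
      & List.In s [:: 0; (1, -1, 0); (0, -1, 0); (0, 1, -2)]].
  exists (t, mul_root (a - s)), s; split => //.
    by case: (in_window_mul_root t (a - s)) => _; apply.
  by apply: chs; rewrite mul_rootK.
case: t' wa; rewrite /in_window => /andP[lo up].
- have [x1|x1] := leP (height a) (1 - l1).
    exists tL, (1, -1, 0); split; last by right; left.
      by rewrite heightD heightN height_lit /scaled_window; lra.
    by move=> c cE; rewrite /children cE subrK; do 3 right; left.
  have [x2|x2] := leP (height a) (- 1).
    exists tM, 0; rewrite subr0; split; last by left.
      by rewrite /scaled_window x1.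
    by move=> c cE; rewrite /children cE; left.
  exists tL, 0; rewrite subr0; split; last by left.
    by rewrite /scaled_window x2.
  by move=> c cE; rewrite /children cE; left.
- have [x1|x1] := leP (height a) (1 - 2 * l1).
    exists tS, 0; rewrite subr0; split; last by left.
      by rewrite /scaled_window lo.
    by move=> c cE; rewrite /children cE; left.
  have [x2|x2] := leP (height a) (- 1 - l1).
    exists tM, (0, -1, 0); split; last by do 2 right; left.
      by rewrite heightD heightN height_lit /scaled_window; lra.
    by move=> c cE; rewrite /children cE -addrA -opprD subr0; right; left.
  exists tL, (0, -1, 0); split; last by do 2 right; left.
    by rewrite heightD heightN height_lit /scaled_window; lra.
  by move=> c cE; rewrite /children cE -addrA -opprD subr0; right; left.
- have [x2|x2] := leP (height a) (- 1 + l1 - 2 * l1 ^+ 2).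
    exists tM, (0, 1, -2); split; last by do 3 right; left.
      by rewrite heightD heightN height_lit /scaled_window; lra.
    by move=> c cE; rewrite /children cE subrK; do 2 right; left.
  exists tL, (0, 1, -2); split; last by do 3 right; left.
    by rewrite heightD heightN height_lit /scaled_window; lra.
  by move=> c cE; rewrite /children cE subrK; do 2 right; left.
Qed.

End Dynamics.

(** * The attractor of the parent map *)

Opaque lambda1 lambda2 lambda3.

Section Attractor.
Variable R : realType.
Local Notation l1 := (lambda1 R).
Local Notation l2 := (lambda2 R).
Local Notation l3 := (lambda3 R).
Implicit Types (a c : cubic_int) (t : tile_type).

Lemma norm_mul_le (x y m d : R) : `|x| <= m -> `|y| <= d -> - (m * d) <= x * y <= m * d.
Proof. by move=> xm yd; rewrite -ler_norml normrM ler_pM. Qed.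

Lemma norm_le_itv (x lo hi m : R) : lo <= x <= hi -> - m <= lo -> hi <= m -> `|x| <= m.
Proof.
move=> /andP[lox xhi] mlo him.
by rewrite ler_norml (le_trans mlo) // (le_trans xhi).
Qed.

Lemma norm_le_of_mul (x w k m : R) :
  0 < k -> k <= w -> - (k * m) <= x * w <= k * m -> `|x| <= m.
Proof.
move=> k0 kw; rewrite -ler_norml normrM => xw.
rewrite -(ler_pM2l k0) (le_trans _ xw) // mulrC ler_wpM2l // (le_trans kw) //.
exact: ler_norm.
Qed.

(** Cramer's rule: the values of a quadratic polynomial at three points bound its
    coefficients. The coefficient [a2] comes from Lagrange
    interpolation, [a1] from a difference quotient. *)
Lemma coarse_bounds (l1 l2 l3 a0 a1 a2 : R) (z := fun y => a0 + a1 * y + a2 * y ^+ 2) :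
  429 / 149 < l1 < 239 / 83 -> - (58 / 109) < l2 < - (83 / 156) ->
  62 / 95 < l3 < 47 / 72 -> `|l3 ^+ 2 - l2 ^+ 2| <= 3 / 20 ->
  `|z l2| <= 18 / 10 -> `|z l3| <= 15 / 10 -> `|z l1| <= 16 ->
  `|a1| <= 4 /\ `|a2| <= 4.
Proof.
move=> /andP[b1 c1] /andP[b2 c2] /andP[b3 c3] hd h2 h3 h1.
have a2_le : `|a2| <= 4.
  have V : a2 * ((l1 - l2) * (l1 - l3) * (l3 - l2)) =
      z l2 * (l1 - l3) - z l3 * (l1 - l2) + z l1 * (l3 - l2) by rewrite /z; ring.
  have p2 : `|l1 - l3| <= 23 / 10 by rewrite ler_norml; lra.
  have p3 : `|l1 - l2| <= 35 / 10 by rewrite ler_norml; lra.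
  have p1 : `|l3 - l2| <= 12 / 10 by rewrite ler_norml; lra.
  have /andP[m1 n1] := norm_mul_le h1 p1; have /andP[m2 n2] := norm_mul_le h2 p2.
  have /andP[m3 n3] := norm_mul_le h3 p3.
  have V1 : 88 / 10 <= (l1 - l2) * (l1 - l3) * (l3 - l2).
    have le3 (p q r p' q' r' : R) : 0 <= p' -> 0 <= q' -> 0 <= r' ->
      p' <= p -> q' <= q -> r' <= r -> p' * q' * r' <= p * q * r.
      by move=> *; rewrite ?ler_pM ?mulr_ge0.
    apply: (le_trans _ (le3 _ _ _ (34 / 10) (22 / 10) (118 / 100) _ _ _ _ _ _));
      clear -b1 c1 b2 c2 b3 c3; lra.
  apply: (norm_le_of_mul _ V1); first by clear; lra.
  by rewrite V; clear -m1 n1 m2 n2 m3 n3; lra.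
split=> //.
have a1E : a1 * (l3 - l2) = z l3 - z l2 - a2 * (l3 ^+ 2 - l2 ^+ 2) by rewrite /z; ring.
have /andP[m1 n1] := norm_mul_le a2_le hd.
move: h2 h3; rewrite [`|z l2| <= _]ler_norml [`|z l3| <= _]ler_norml.
move=> /andP[? ?] /andP[? ?].
apply: (@norm_le_of_mul _ (l3 - l2) 1) => //; first by lra.
by rewrite a1E; lra.
Qed.

(** Replacing the irrational powers of a root by nearby hundredths turns bounds
    on a conjugate into linear inequalities between integers. *)
Lemma approx_bounds (a0 a1 a2 : int) (x c1 c2 m M : R) (k1 k2 lo hi : int) :
  `|a1%:~R : R| <= 4 -> `|a2%:~R : R| <= 4 ->
  `|x - k1%:~R / 100| <= c1 -> `|x ^+ 2 - k2%:~R / 100| <= c2 ->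
  m <= ceval x (a0, a1, a2) <= M ->
  lo%:~R <= 100 * (m - 4 * (c1 + c2)) -> 100 * (M + 4 * (c1 + c2)) <= hi%:~R ->
  lo <= 100 * a0 + k1 * a1 + k2 * a2 <= hi.
Proof.
move=> h1 h2 d1 d2 /= /andP[mz zM] lom Mhi.
have /andP[p1 q1] := norm_mul_le h1 d1; have /andP[p2 q2] := norm_mul_le h2 d2.
rewrite -(ler_int R) -[X in _ && X](ler_int R) !intrD !intrM.
by apply/andP; split; lra.
Qed.

(** The typed cubic integers with height in their window and plane position near
    the invariant box, see [core_of_near]. *)
Definition core (q : tile_type * cubic_int) : Prop :=
  match q.1 with
  | tL => List.In q.2 [:: (0, 0, 0); (0, 2, -1); (1, -1, 0)]
  | tM => List.In q.2 [:: (0, -1, 0); (1, 1, -1)]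
  | tS => List.In q.2 [:: (0, 1, -2); (2, 0, -2)]
  end.

(** The box [-1.6, 1.7] x [-0.8, 1.4] is mapped into itself by every parent map,
    see [near_core_parent]. *)
Definition near_core (e : R) a : Prop :=
  (- (16 / 10) - e <= ceval l2 a <= 17 / 10 + e) /\
  (- (8 / 10) - e <= ceval l3 a <= 14 / 10 + e).

(** The integer inequalities have the listed solutions and, because the rounded
    windows are slightly too large, three solutions whose heights are the open
    ends of the windows. *)
Lemma core_of_near t a : near_core (1 / 10) a -> in_window R (t, a) -> core (t, a).
Proof.
case: a => [[a0 a1] a2] [n2 n3] w.
have h2 : `|ceval l2 (a0, a1, a2)| <= 18 / 10 by apply: (norm_le_itv n2); clear; lra.
have h3 : `|ceval l3 (a0, a1, a2)| <= 15 / 10 by apply: (norm_le_itv n3); clear; lra.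
have hx : match t with
  | tL => - (29 / 10) <= height R (a0, a1, a2) <= 0
  | tM => - (65 / 12) <= height R (a0, a1, a2) <= - (23 / 8)
  | tS => - (78 / 5) <= height R (a0, a1, a2) <= - (178 / 13)
  end :> bool.
  move: w (lambda1_bounds R) (lambda1_sq_bounds R); rewrite /in_window /=.
  by move: (height R (a0, a1, a2)) (lambda1 R); clear; case: t => x m *; lra.
have h1 : `|height R (a0, a1, a2)| <= 16.
  by case: t hx {w} => hx; apply: (norm_le_itv hx); clear; lra.
have [k1 k2] : `|a1%:~R : R| <= 4 /\ `|a2%:~R : R| <= 4.
  apply: coarse_bounds h2 h3 h1;
    rewrite ?lambda1_bounds ?lambda2_bounds ?lambda3_bounds //.
  have := lambda2_sq_bounds R; have := lambda3_sq_bounds R.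
  by rewrite ler_norml; move: (l2 ^+ 2) (l3 ^+ 2); clear; move=> p q; lra.
have e2 : -174 <= 100 * a0 + (-53) * a1 + 28 * a2 <= 184.
  apply: (approx_bounds k1 k2 _ _ n2).
  - rewrite ler_norml; move: (lambda2_bounds R); move: l2; clear => x.
    move=> xb; instantiate (1 := 1 / 200); lra.
  - rewrite ler_norml; move: (lambda2_sq_bounds R); move: (l2 ^+ 2); clear => x.
    move=> xb; instantiate (1 := 1 / 200); lra.
  - by clear; lra.
  - by clear; lra.
have e3 : -94 <= 100 * a0 + 65 * a1 + 43 * a2 <= 154.
  apply: (approx_bounds k1 k2 _ _ n3).
  - rewrite ler_norml; move: (lambda3_bounds R); move: l3; clear => x.
    move=> xb; instantiate (1 := 1 / 200); lra.
  - rewrite ler_norml; move: (lambda3_sq_bounds R); move: (l3 ^+ 2); clear => x.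
    move=> xb; instantiate (1 := 1 / 200); lra.
  - by clear; lra.
  - by clear; lra.
have d1 : `|l1 - 288%:~R / 100| <= 1 / 200.
  by rewrite ler_norml; move: (lambda1_bounds R); move: l1; clear => x; lra.
have d1' : `|l1 ^+ 2 - 829%:~R / 100| <= 1 / 200.
  by rewrite ler_norml; move: (lambda1_sq_bounds R); move: (l1 ^+ 2); clear => x; lra.
have int_bound (c : int) : `|c%:~R : R| <= 4 -> -4 <= c <= 4.
  by rewrite -intr_norm -[4 : R]/(4%:~R : R) ler_int ler_norml.
have i1 := int_bound _ k1; have i2 := int_bound _ k2.
have ex m M lo hi : m <= height R (a0, a1, a2) <= M ->
    lo%:~R <= 100 * (m - 4 * (1 / 200 + 1 / 200)) ->
    100 * (M + 4 * (1 / 200 + 1 / 200)) <= hi%:~R ->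
    lo <= 100 * a0 + 288 * a1 + 829 * a2 <= hi.
  by apply: approx_bounds.
case: t w hx => w hx; rewrite /core.
- have e1 : -294 <= 100 * a0 + 288 * a1 + 829 * a2 <= 6.
    by apply: (ex _ _ _ _ hx); clear; lra.
  have : [|| [&& a0 == 0, a1 == 0 & a2 == 0], [&& a0 == 0, a1 == 2 & a2 == -1],
     [&& a0 == 1, a1 == -1 & a2 == 0] | [&& a0 == 0, a1 == -1 & a2 == 0]].
    by move: e1 e2 e3 i1 i2; clear; lia.
  case/or4P => /and3P[/eqP ? /eqP ? /eqP ?]; subst a0 a1 a2; try by rewrite /=; auto.
  suff : (1 : R) < 0 by rewrite ltr10.
  by move: w; rewrite /in_window height_lit /=; move: (lambda1 R); clear => x; lra.
- have e1 : -547 <= 100 * a0 + 288 * a1 + 829 * a2 <= -282.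
    by apply: (ex _ _ _ _ hx); clear; lra.
  have : [|| [&& a0 == 0, a1 == -1 & a2 == 0], [&& a0 == 1, a1 == 1 & a2 == -1]
    | [&& a0 == 0, a1 == 1 & a2 == -1]].
    by move: e1 e2 e3 i1 i2; clear; lia.
  case/or3P => /and3P[/eqP ? /eqP ? /eqP ?]; subst a0 a1 a2; try by rewrite /=; auto.
  suff : (1 : R) < 0 by rewrite ltr10.
  by move: w; rewrite /in_window height_lit /=; move: (lambda1 R); clear => x; lra.
- have e1 : -1564 <= 100 * a0 + 288 * a1 + 829 * a2 <= -1364.
    by apply: (ex _ _ _ _ hx); clear; lra.
  have : [|| [&& a0 == 0, a1 == 1 & a2 == -2], [&& a0 == 2, a1 == 0 & a2 == -2]
    | [&& a0 == 1, a1 == 0 & a2 == -2]].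
    by move: e1 e2 e3 i1 i2; clear; lia.
  case/or3P => /and3P[/eqP ? /eqP ? /eqP ?]; subst a0 a1 a2; try by rewrite /=; auto.
  suff : (1 : R) < 0 by rewrite ltr10.
  by move: w; rewrite /in_window height_lit /=; move: (lambda1 R); clear => x; lra.
Qed.

(** The points [(0, 0, 0)] of type [tL] and [(1, 1, -1)] of type [tM] are the
    seed; the others descend from the former in at most three steps. *)
Lemma core_generated q : core q -> generated R q.
Proof.
have gL : generated R (tL, (0, 0, 0)).
  apply: generated_seed; last by left.
  by rewrite -[(0, 0, 0)]/(0 : cubic_int) seedL; left.
have gL1 : generated R (tL, (1, -1, 0)).
  by apply: generated_child gL _; do 3 right; left.
have gL2 : generated R (tL, (0, 2, -1)).
  by apply: generated_child gL1 _; do 3 right; left.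
case: q => t a; rewrite /core; case: t => /=; case=> [<- //|].
- by case=> [<- //|[<-|//]].
- by apply: generated_child gL _; right; left.
- case=> [<-|//]; apply: generated_seed; last by right; left.
  by rewrite seedM; right.
- by apply: generated_child gL _; do 2 right; left.
- by case=> [<-|//]; apply: generated_child gL2 _; do 2 right; left.
Qed.

(** Both [|lambda2|] and [lambda3] are smaller than [2/3], so the distance to the
    box shrinks by that factor. *)
Lemma near_core_parent (e : R) a s : 0 <= e -> near_core (3 / 2 * e) a ->
  List.In s [:: 0; (1, -1, 0); (0, -1, 0); (0, 1, -2)] ->
  near_core e (mul_root (a - s)).
Proof.
move=> e0 [h2 h3] hs; rewrite /near_core !ceval_mul_root ?cevalB;
  [|exact: lambda3_root|exact: lambda2_root].
have s2 : - (11 / 10) <= ceval l2 s <= 154 / 100.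
  move: (lambda2_bounds R) (lambda2_sq_bounds R).
  case: hs => [<-|[<-|[<-|[<-|//]]]]; rewrite /ceval /=;
    move: (lambda2 R); clear => x; lra.
have s3 : - (2 / 3) <= ceval l3 s <= 7 / 20.
  move: (lambda3_bounds R) (lambda3_sq_bounds R).
  case: hs => [<-|[<-|[<-|[<-|//]]]]; rewrite /ceval /=;
    move: (lambda3 R); clear => x; lra.
split.
  move: (lambda2_bounds R) h2 s2; move: (ceval l2 a) (ceval l2 s) (lambda2 R).
  move: e0; clear => e0 x y m /andP[m1 m2] /andP[x1 x2] /andP[y1 y2].
  by apply/andP; split; nra.
move: (lambda3_bounds R) h3 s3; move: (ceval l3 a) (ceval l3 s) (lambda3 R).
move: e0; clear => e0 x y m /andP[m1 m2] /andP[x1 x2] /andP[y1 y2].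
by apply/andP; split; nra.
Qed.

Lemma generated_near n q :
  near_core ((3 / 2) ^+ n * (1 / 10)) q.2 -> in_window R q -> generated R q.
Proof.
elim: n q => [|n IHn] q nq wq.
  apply: core_generated; case: q nq wq => t a nq wq.
  by apply: core_of_near => //; move: nq; rewrite expr0 mul1r.
have [q0 [s [wq0 cq0 q0E sS]]] := parent_exists wq.
apply: generated_child cq0; apply: IHn => //; rewrite q0E.
apply: near_core_parent sS; first by rewrite mulr_ge0 ?exprn_ge0 //; clear; lra.
by rewrite mulrA -exprS.
Qed.

(** Every point is within [(3/2)^n / 10] of the box for some [n], and [n] steps
    back lead into the core. *)
Lemma generatedP q : generated R q <-> in_window R q.
Proof.
split=> [[k _ /window_of_generated[q' + wq']]|wq].
  case: q q' wq' => t a [t' a'] wq' [->] /(congr1 (fun v : 'rV[R]_2 => v 0 0)).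
  by rewrite !vec2_0 => /(ceval_inj (lambda2_root R)) ->.
pose B := 10 * (2 * (`|ceval l2 q.2| + `|ceval l3 q.2|)).
have B0 : 0 <= B by rewrite /B !mulr_ge0 ?addr_ge0.
have /ltW := archi_boundP B0; move: (Num.bound B) => n Bn.
apply: (@generated_near n) => //.
have pow_ge k : 1 + k%:R / 2 <= (3 / 2) ^+ k :> R.
  elim: k => [|k IHk]; first by rewrite expr0; lra.
  rewrite exprS -natr1.
  have := ler0n R k; move: k%:R ((3 / 2) ^+ k) IHk; clear => x y; lra.
have e1 : B / 20 <= (3 / 2) ^+ n * (1 / 10).
  by move: (pow_ge n) Bn; clear; move: n%:R ((3 / 2) ^+ n) B => x y z; lra.
have e2 : B / 20 = `|ceval l2 q.2| + `|ceval l3 q.2| by rewrite /B; field.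
move: e1; rewrite e2 => e1; rewrite /near_core.
have x2 := ler_norm (ceval l2 q.2); have y2 := ler_norm (- ceval l2 q.2).
have x3 := ler_norm (ceval l3 q.2); have y3 := ler_norm (- ceval l3 q.2).
have p2 := normr_ge0 (ceval l2 q.2); have p3 := normr_ge0 (ceval l3 q.2).
rewrite !normrN in y2 y3.
move: (`|ceval l2 q.2|) (`|ceval l3 q.2|) (ceval l2 q.2) (ceval l3 q.2)
  ((3 / 2) ^+ n) e1 x2 y2 x3 y3 p2 p3.
by clear => x y z w v *; split; lra.
Qed.

End Attractor.

(** * Areas of balls *)

Section Balls.
Variable R : realType.
Implicit Types (r s : R).

Lemma enorm_ge0 n (x : 'rV[R]_n) : 0 <= enorm x.
Proof. exact: sqrtr_ge0. Qed.

Lemma enormZ n s (x : 'rV[R]_n) : 0 <= s -> enorm (s *: x) = s * enorm x.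
Proof.
move=> s0; rewrite /enorm -[s in RHS](ger0_norm s0) -sqrtr_sqr -sqrtrM ?sqr_ge0 //.
by congr Num.sqrt; rewrite mulr_sumr; apply: eq_bigr => i _; rewrite mxE exprMn.
Qed.

Lemma enorm_coord n (x : 'rV[R]_n) i : `|x 0 i| <= enorm x.
Proof.
rewrite -sqrtr_sqr ler_wsqrtr // (bigD1 i) //= lerDl.
by apply: sumr_ge0 => j _; apply: sqr_ge0.
Qed.

(** Scaling a cover by boxes gives a cover of the scaled ball. *)
Lemma lebesgue_eballZ n s r : 0 < s ->
  (lebesgue (@eball R n (s * r)) <= (s ^+ n)%:E * lebesgue (@eball R n r))%E.
Proof.
move=> s0; have sn0 : 0 < s ^+ n by rewrite exprn_gt0.
rewrite -lee_pdivrMl //; apply/ereal_infP => _ [a [b [ab cover ->]]].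
rewrite lee_pdivrMl //; apply: ge_ereal_inf.
exists ((s ^+ n)%:E * (\sum_(0 <= k <oo) (\prod_i (b k 0 i - a k 0 i))%:E))%E => //.
exists (fun k => s *: a k), (fun k => s *: b k); split.
- by move=> k i; rewrite !mxE ler_pM2l.
- move=> x; rewrite /eball /= => xsr.
  have /cover[k _ /= kx] : eball r (s^-1 *: x).
    rewrite /eball /= enormZ ?invr_ge0 ?(ltW s0) //.
    by rewrite ler_pdivrMl.
  exists k => //= i; move: (kx i); rewrite !mxE.
  by rewrite ler_pdivlMl // ler_pdivrMl.
- rewrite -nneseriesZl; last first.
    by move=> k _; rewrite lee_fin prodr_ge0 // => i _; rewrite subr_ge0.
  apply: eq_eseriesr => k _; rewrite -EFinM; congr (_%:E).
  apply/esym; under eq_bigr do rewrite !mxE -mulrBr.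
  by rewrite big_split /= prodr_const card_ord.
Qed.

Lemma lebesgue_eball n r : 0 < r ->
  lebesgue (@eball R n r) = ((r ^+ n)%:E * lebesgue (@eball R n 1))%E.
Proof.
move=> r0; apply/eqP; rewrite eq_le -{1}[r in leLHS]mulr1 lebesgue_eballZ //=.
rewrite -lee_pdivlMl ?exprn_gt0 // -exprVn.
by rewrite -{1}(mulVf (lt0r_neq0 r0)) lebesgue_eballZ ?invr_gt0.
Qed.

Lemma lebesgue_eball_fin : (lebesgue (@eball R 2 1) < +oo)%E.
Proof.
apply: (@le_lt_trans _ _ (4%:E)); last exact: ltry.
apply: ge_ereal_inf.
pose a (k : nat) : 'rV[R]_2 := if k == 0%N then const_mx (-1) else 0.
pose b (k : nat) : 'rV[R]_2 := if k == 0%N then const_mx 1 else 0.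
exists (\sum_(0 <= k <oo) (\prod_i (b k 0 i - a k 0 i))%:E)%E.
  exists a, b; split=> //.
    by move=> k i; rewrite /a /b; case: ifP; rewrite !mxE //; lra.
  move=> x /= x1; exists 0 => // i; rewrite /a /b /= !mxE.
  by rewrite -ler_norml (le_trans (enorm_coord _ _)).
have ab k i : a k 0 i <= b k 0 i by rewrite /a /b; case: ifP; rewrite !mxE //; lra.
rewrite nneseries_recl //; last first.
  by move=> k _; rewrite lee_fin prodr_ge0 // => i _; rewrite subr_ge0.
rewrite eseries0 ?adde0; last first.
  by move=> [|k] //= _ _; rewrite big_ord_recl !mxE subrr mul0r.
rewrite lee_fin !big_ord_recl big_ord0 !mxE; lra.
Qed.

(** A square of side [1/2] fits into the ball, and countable subadditivity of the
    product measure bounds the volume of any cover of it from below. *)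
Lemma lebesgue_eball_gt0 : (0 < lebesgue (@eball R 2 1))%E.
Proof.
apply: (@lt_le_trans _ _ ((1 / 4)%:E)); first by rewrite lte_fin; lra.
apply/ereal_infP => _ [a [b [ab cover ->]]].
pose D : set (R * R) := `[0, 1 / 2] `*` `[0, 1 / 2].
pose E k : set (R * R) := `[a k 0 0, b k 0 0] `*` `[a k 0 1, b k 0 1].
have muE x y : x <= y -> @lebesgue_measure R `[x, y]%classic = (y - x)%:E.
  move=> xy; rewrite lebesgue_measure_itv /= lte_fin; case: ltP => // yx.
  by congr _%:E; apply/eqP; rewrite eq_sym subr_eq0 eq_le xy yx.
have -> : (1 / 4)%:E = (@lebesgue_measure R \x @lebesgue_measure R)%E D.
  by rewrite product_measure1E //= ?muE; [rewrite -EFinM; congr _%:E; lra|lra].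
have -> : (\sum_(0 <= k <oo) (\prod_i (b k 0 i - a k 0 i))%:E)%E =
   (\sum_(0 <= k <oo) (@lebesgue_measure R \x @lebesgue_measure R)%E (E k))%E.
  apply: eq_eseriesr => k _; rewrite product_measure1E //= ?muE //.
  rewrite !big_ord_recl big_ord0 mulr1 -EFinM.
  by congr (_ * (b k 0 _ - a k 0 _))%:E; apply: val_inj.
apply: measure_sigma_subadditive.
- by move=> k; apply: measurableX.
- exact: measurableX.
move=> [x y] [/=]; rewrite !in_itv /= => /andP[x0 x1] /andP[y0 y1].
have /cover[k _ /= kx] : eball 1 (vec2 x y).
  rewrite /eball /= /enorm -[leRHS]sqrtr1 ler_wsqrtr //.
  by rewrite !big_ord_recl big_ord0 !mxE /=; nra.
exists k => //; split; rewrite /= in_itv /=;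
  [have := kx 0|have := kx 1]; by rewrite mxE.
Qed.

End Balls.

(** * Counting points in balls *)

Definition ncard (T : choiceType) (A : set T) : nat :=
  size (finmap.enum_fset (fset_set A)).

Lemma ncard_le (T U : choiceType) (A : set T) (B : set U) :
  finite_set B -> (A #<= B)%card -> (ncard A <= ncard B)%N.
Proof.
move=> finB AB; have finA := card_le_finite AB finB.
have [/finite_setP[n Bn] /finite_setP[m Am]] := (finB, finA).
rewrite /ncard (card_fset_set Bn) (card_fset_set Am).
by rewrite -card_le_II -(card_le_eqr Bn) -(card_le_eql Am).
Qed.

Lemma ncard_le_inj (T U : choiceType) (A : set T) (B : set U) (f : T -> U) :
  finite_set B -> set_inj A f -> f @` A `<=` B -> (ncard A <= ncard B)%N.
Proof.
move=> finB injf fAB; apply: ncard_le => //.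
apply: (card_le_trans _ (subset_card_le fAB)).
by rewrite -(card_le_eql (inj_card_eq injf)).
Qed.

Lemma ncardX_le (T U : choiceType) (A : set T) (B : set U) :
  finite_set A -> finite_set B -> (ncard (A `*` B) <= ncard A * ncard B)%N.
Proof.
move=> finA finB; rewrite /ncard -(size_allpairs pair).
apply: uniq_leq_size => // -[x y]; rewrite in_fset_set; last exact: finite_setX.
rewrite inE => -[/= Ax By]; apply/allpairsP; exists (x, y).
by rewrite !in_fset_set // !inE.
Qed.

Lemma ncardU_le (T : choiceType) (A B : set T) :
  finite_set A -> finite_set B -> (ncard (A `|` B) <= ncard A + ncard B)%N.
Proof.
move=> finA finB; rewrite /ncard -size_cat.
apply: uniq_leq_size => // x; rewrite in_fset_set ?finite_setU // inE mem_cat.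
by rewrite !in_fset_set // => -[Ax|Bx]; apply/orP; [left|right]; rewrite inE.
Qed.

Lemma ncard_II n : ncard `I_n = n.
Proof. exact: card_fset_set. Qed.

Section Limit.
Variable R : realType.

(** A Fekete-type argument: the limit is the infimum of [H (r + C) / r^2]. For
    the upper bound one fixes a nearly optimal radius [r0] and covers a large
    radius [t] by the least multiple of [r0] above it. *)
Lemma cvg_of_scaling (H : R -> R) (C : R) : 0 <= C -> (forall r, 0 <= H r) ->
  {homo H : x y / x <= y} ->
  (forall k r, 0 < r -> H (k.+1%:R * r) <= k.+1%:R ^+ 2 * H (r + C)) ->
  exists L : R, H r / r ^+ 2 @[r --> +oo%R] --> L.
Proof.
move=> C0 H0 Hmono Hscale.
pose S := [set H (r + C) / r ^+ 2 | r in [set r | 0 < r]].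
have S_ge0 : lbound S 0 by move=> _ [r r0 <-]; rewrite divr_ge0 ?sqr_ge0.
have Sne : S !=set0 by exists (H (1 + C) / 1 ^+ 2); exists 1 => //=; apply: ltr01.
have Sinf : has_inf S by split=> //; exists 0.
have L0 : 0 <= inf S := lb_le_inf Sne S_ge0.
exists (inf S); set L := inf S in L0 *; apply/cvgrPdist_le => e e0.
have e2 : 0 < e / 2 by lra.
have [_ [r0 /= r0_gt0 <-]] := inf_adherent e2 Sinf; rewrite -/L; set q := _ / _ => qL.
have q0 : 0 <= q by rewrite divr_ge0 ?sqr_ge0.
have qE : H (r0 + C) = q * r0 ^+ 2 by rewrite /q divfK // expf_neq0 // gt_eqF.
clearbody q.
(* for larger [t] one has [q (1 + r0 / t)^2 <= q + e / 2] and
   [L (1 - C / t)^2 >= L - e] *)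
exists (r0 + C + 6 * r0 * q / e + 2 * L * C / e); split; first exact: num_real.
move=> t; have p1 : 0 <= 6 * r0 * q / e.
  by do 3 ?[apply: mulr_ge0]; rewrite ?invr_ge0 ?(ltW r0_gt0) ?(ltW e0).
have p2 : 0 <= 2 * L * C / e.
  by do 3 ?[apply: mulr_ge0]; rewrite ?invr_ge0 ?(ltW e0).
move=> tT; have t0 : 0 < t by lra.
have t1 : 6 * r0 * q <= e * t by rewrite [e * t]mulrC -ler_pdivrMr //; lra.
have t2 : 2 * L * C <= e * t by rewrite [e * t]mulrC -ler_pdivrMr //; lra.
have tpos : 0 < t ^+ 2 by rewrite exprn_gt0.
rewrite ler_distlC; apply/andP; split.
  (* the infimum at the radius t - C bounds H t from below *)
  have tC : 0 < t - C by lra.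
  have /(ge_inf (ex_intro _ 0 S_ge0)) : S (H t / (t - C) ^+ 2).
    by exists (t - C); rewrite //= subrK.
  rewrite -/L.
  rewrite !ler_pdivlMr ?exprn_gt0 // => LH.
  apply: le_trans LH; nra.
have [k /andP[k1 k2]] : exists k : nat, k%:R * r0 <= t <= k.+1%:R * r0.
  exists (Num.truncn (t / r0)).
  have /andP[h1 h2] := truncn_itv (divr_ge0 (ltW t0) (ltW r0_gt0)).
  by rewrite -ler_pdivlMr // h1 -ler_pdivrMr // ltW.
rewrite ler_pdivrMr //.
apply: (le_trans (Hmono _ _ k2)); apply: (le_trans (Hscale k r0 r0_gt0)).
rewrite qE.
have kr : k.+1%:R * r0 <= t + r0 by rewrite -natr1 mulrDl mul1r lerD2r.
have -> : k.+1%:R ^+ 2 * (q * r0 ^+ 2) = q * (k.+1%:R * r0) ^+ 2 by ring.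
apply: (@le_trans _ _ (q * (t + r0) ^+ 2)).
  apply: ler_wpM2l => //.
  by rewrite ler_pXn2r ?nnegrE ?mulr_ge0 ?addr_ge0 ?(ltW r0_gt0) ?(ltW t0).
have rt : r0 <= t by lra.
have : q * (t + r0) ^+ 2 <= q * (t ^+ 2 + 3 * r0 * t) by apply: ler_wpM2l => //; nra.
move=> h; apply: (le_trans h); nra.
Qed.

End Limit.

Section Density.
Variable R : realType.
Implicit Types (r : R) (X Y : set 'rV[R]_2).

Definition ball_count X r : nat := ncard (X `&` eball r).

Lemma has_density_of_ball_count X (L : R) : (forall r, finite_set (X `&` eball r)) ->
  (ball_count X r)%:R / r ^+ 2 @[r --> +oo%R] --> L ->
  has_density X (L / fine (lebesgue (@eball R 2 1))).
Proof.
move=> Xfin XL; set c := fine _.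
have leb1 : lebesgue (@eball R 2 1) = c%:E.
  rewrite fineK // ge0_fin_numE ?lebesgue_eball_fin //.
  exact/ltW/lebesgue_eball_gt0.
have c0 : 0 < c by rewrite -lte_fin -leb1 lebesgue_eball_gt0.
have cL : ((ball_count X r)%:R / r ^+ 2) / c @[r --> +oo%R] --> L / c.
  by apply: cvgM XL (cvg_cst _).
have : ((((ball_count X r)%:R / r ^+ 2) / c)%:E @[r --> +oo%R] --> (L / c)%:E)%E.
  by apply: cvg_EFin => //; apply: nearW.
apply: cvg_trans; apply: near_eq_cvg.
exists 0; split; first exact: num_real.
move=> r r0; rewrite lebesgue_eball // leb1 /counting asboolT //.
rewrite -EFinM inver gt_eqF ?mulr_gt0 ?exprn_gt0 // -EFinM.
by congr EFin; rewrite /ball_count /ncard -mulrA -invfM.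
Qed.

Lemma cvg_ball_count_setU X Y (L : R) :
  (forall r, finite_set (X `&` eball r)) -> finite_set Y ->
  (ball_count X r)%:R / r ^+ 2 @[r --> +oo%R] --> L ->
  (ball_count (X `|` Y) r)%:R / r ^+ 2 @[r --> +oo%R] --> L.
Proof.
move=> Xfin Yfin /cvgrPdist_le XL; apply/cvgrPdist_le => e e0.
have e2 : 0 < e / 2 by lra.
have Y0 : 0 <= 2 * (ncard Y)%:R / e by rewrite divr_ge0 ?(ltW e0) // mulr_ge0.
near=> t.
have tX : `|L - (ball_count X t)%:R / t ^+ 2| <= e / 2 by near: t; apply: XL.
have tY : 1 + 2 * (ncard Y)%:R / e < t.
  by near: t; apply: nbhs_pinfty_gt; apply: num_real.
have t0 : 1 < t by lra.
have t2 : 0 < t ^+ 2 by rewrite exprn_gt0; lra.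
have tN : 2 * (ncard Y)%:R <= e * t by rewrite [e * t]mulrC -ler_pdivrMr //; lra.
have c1 : (ball_count X t)%:R <= (ball_count (X `|` Y) t)%:R :> R.
  rewrite ler_nat; apply: ncard_le; last first.
    by apply: subset_card_le => x [Xx xt]; split=> //; left.
  by rewrite setIUl finite_setU; split=> //; apply: finite_setIl.
have c2 : (ball_count (X `|` Y) t)%:R <= (ball_count X t)%:R + (ncard Y)%:R :> R.
  rewrite -natrD ler_nat /ball_count setIUl.
  apply: (leq_trans (ncardU_le _ _)) => //; first exact: finite_setIl.
  rewrite leq_add2l; apply: ncard_le => //; by apply: subset_card_le => x [].
move: tX; rewrite !ler_distlC => /andP[h1 h2]; apply/andP; split.
  apply: (@le_trans _ _ ((ball_count X t)%:R / t ^+ 2)); first by lra.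
  by apply: ler_wpM2r => //; rewrite invr_ge0 ltW.
move: h2; rewrite !ler_pdivrMr // => h2; nra.
Unshelve. all: by end_near.
Qed.

Lemma enormD (x y : 'rV[R]_2) : enorm (x + y) <= enorm x + enorm y.
Proof.
have sq (z : 'rV[R]_2) : enorm z ^+ 2 = z 0 0 ^+ 2 + z 0 1 ^+ 2.
  rewrite sqr_sqrtr; last by apply: sumr_ge0 => i _; apply: sqr_ge0.
  by rewrite !big_ord_recl big_ord0 addr0; congr (_ + z 0 _ ^+ 2); apply: val_inj.
rewrite -(ler_pXn2r (n := 2)) ?nnegrE ?addr_ge0 ?enorm_ge0 // sqrrD !sq !mxE.
have : x 0 0 * y 0 0 + x 0 1 * y 0 1 <= enorm x * enorm y.
  apply: le_trans (ler_norm _) _.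
  rewrite -(ler_pXn2r (n := 2)) ?nnegrE ?mulr_ge0 ?enorm_ge0 // real_normK ?num_real //.
  rewrite exprMn !sq.
  move: (x 0 0) (x 0 1) (y 0 0) (y 0 1) => p q s t.
  rewrite -subr_ge0.
  have -> : (p ^+ 2 + q ^+ 2) * (s ^+ 2 + t ^+ 2) - (p * s + q * t) ^+ 2 =
    (p * t - q * s) ^+ 2 by ring.
  exact: sqr_ge0.
by lra.
Qed.

Lemma enormN (x : 'rV[R]_2) : enorm (- x) = enorm x.
Proof. by congr Num.sqrt; apply: eq_bigr => i _; rewrite mxE sqrrN. Qed.

(** Euclidean division of the indices by [k + 1] sends the points in the ball of
    radius [(k + 1) r] to points in the ball of radius [r + D]; the fibres have
    at most [(k + 1)^2] elements, one for each pair of remainders. Hence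
    [cvg_of_scaling] applies. *)
Lemma ball_count_near_lattice X (F : int * int -> 'rV[R]_2) (v w : 'rV[R]_2) (C : R) :
  (forall r, finite_set (X `&` eball r)) -> injective F -> X = range F ->
  (forall z, enorm (F z - (z.1%:~R *: v + z.2%:~R *: w)) <= C) ->
  exists L : R, (ball_count X r)%:R / r ^+ 2 @[r --> +oo%R] --> L.
Proof.
move=> Xfin Finj XE FC.
have C0 : 0 <= C := le_trans (enorm_ge0 _) (FC (0, 0)).
have D0 : 0 <= 2 * C + enorm v + enorm w by rewrite !addr_ge0 ?mulr_ge0 ?enorm_ge0.
apply: (cvg_of_scaling D0).
- by move=> r; apply: ler0n.
- move=> r s rs; rewrite ler_nat; apply: ncard_le => //.
  by apply: subset_card_le => x [Xx /= xr]; split=> //; apply: le_trans xr rs.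
move=> k r r0; rewrite -natrX -natrM ler_nat mulnC.
set D := 2 * C + enorm v + enorm w.
pose T (z : int * int) := z.1%:~R *: v + z.2%:~R *: w.
pose kk : int := k.+1%:Z.
have TD z z' : T (z + z') = T z + T z'.
  by rewrite /T /= !intrD !scalerDl addrACA.
have inv x : exists z, range F x -> F z = x.
  by case: (pselect (range F x)) => [[z _ <-]|nx]; [exists z|exists (0, 0)].
have [f fK] := choice inv.
pose q z : int * int := ((z.1 %/ kk)%Z, (z.2 %/ kk)%Z).
pose rm z : nat * nat := (`|(z.1 %% kk)%Z|%N, `|(z.2 %% kk)%Z|%N).
pose B := (X `&` eball (r + D)) `*` (`I_k.+1 `*` `I_k.+1).
have finB : finite_set B.
  by apply: finite_setX => //; apply: finite_setX; apply: finite_II.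
have zE (a : int) : a = (a %/ kk)%Z * kk + `|(a %% kk)%Z|%N :> int.
  by rewrite gez0_abs ?modz_ge0 // -divz_eq.
have remlt (a : int) : (`|(a %% kk)%Z| < k.+1)%N.
  by rewrite -ltz_nat gez0_abs ?modz_ge0 // ltz_pmod.
apply: (@leq_trans (ncard B)); last first.
  apply: (leq_trans (ncardX_le _ _)) => //.
    by apply: finite_setX; apply: finite_II.
  rewrite leq_mul2l; apply/orP; right.
  by apply: (leq_trans (ncardX_le _ _)); rewrite ?ncard_II ?mulnn //; apply: finite_II.
apply: (@ncard_le_inj _ _ _ _ (fun x => (F (q (f x)), rm (f x)))) => //.
  move=> x y; rewrite !inE => -[Xx _] [Xy _] [/Finj[q1 q2] r1 r2].
  rewrite XE in Xx Xy; rewrite -(fK _ Xx) -(fK _ Xy); congr F.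
  case: (f x) (f y) q1 q2 r1 r2 => [x1 x2] [y1 y2] /= q1 q2 r1 r2.
  by congr (_, _); [rewrite (zE x1) (zE y1) q1 r1|rewrite (zE x2) (zE y2) q2 r2].
move=> _ [x [Xx /= xr] <-]; rewrite XE in Xx.
split; split; rewrite /= ?remlt //; first by rewrite XE; exists (q (f x)).
have fx := fK _ Xx; move: (f x) fx => z zx.
have k0 : 0 < k.+1%:R :> R by rewrite ltr0n.
have kV : 0 < k.+1%:R^-1 :> R by rewrite invr_gt0.
pose t1 : R := `|(z.1 %% kk)%Z|%N%:R / k.+1%:R.
pose t2 : R := `|(z.2 %% kk)%Z|%N%:R / k.+1%:R.
have tb (a : int) : 0 <= (`|(a %% kk)%Z|%N%:R / k.+1%:R : R) <= 1.
  by rewrite divr_ge0 //= ler_pdivrMr // mul1r ler_nat ltnW.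
have Tq : T (q z) = k.+1%:R^-1 *: x - k.+1%:R^-1 *: (x - T z) - (t1 *: v + t2 *: w).
  rewrite -scalerBr opprB addrCA subrr addr0 /T /q /=.
  have quo (a : int) : (a %/ kk)%Z%:~R =
      k.+1%:R^-1 * a%:~R - `|(a %% kk)%Z|%N%:R / k.+1%:R :> R.
    rewrite {2}(zE a) intrD intrM -!pmulrn; field.
    by rewrite gt_eqF.
  by rewrite !quo !scalerBl scalerDr !scalerA opprD addrACA.
have -> : F (q z) = (F (q z) - T (q z)) +
    (k.+1%:R^-1 *: x + (- (k.+1%:R^-1 *: (x - T z)) - (t1 *: v + t2 *: w))).
  by rewrite [X in _ + X]addrA -Tq subrK.
have := FC (q z); rewrite -/(T _) => F1.
have := FC z; rewrite -/(T _) zx => F2.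
apply: (le_trans (enormD _ _)).
apply: (@le_trans _ _ (C + (r + (C + (enorm v + enorm w))))); last first.
  by rewrite /D; lra.
apply: lerD => //; apply: (le_trans (enormD _ _)); apply: lerD.
  by rewrite enormZ ?(ltW kV) // ler_pdivrMl.
apply: (le_trans (enormD _ _)); rewrite !enormN; apply: lerD.
  rewrite enormZ ?(ltW kV) // ler_pdivrMl //; apply: (le_trans F2).
  by rewrite ler_peMl // ler1n.
apply: (le_trans (enormD _ _)).
have /andP[a1 b1] := tb z.1; have /andP[a2 b2] := tb z.2.
by rewrite !enormZ //; apply: lerD; rewrite ler_piMl ?enorm_ge0.
Qed.

End Density.

Section CosetRepresentatives.
Variable R : realType.
Local Notation l1 := (lambda1 R).
Local Notation l2 := (lambda2 R).
Local Notation l3 := (lambda3 R).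
Local Notation phys := (phys R).
Local Notation height := (height R).
Implicit Types (a c : cubic_int) (r : R).

Lemma phys_inj : injective phys.
Proof.
move=> a c /(congr1 (fun v : 'rV[R]_2 => v 0 0)); rewrite !vec2_0.
exact/ceval_inj/lambda2_root.
Qed.

Lemma finite_int_ball (N : nat) : finite_set [set m : int | (`|m| <= N)%N].
Proof.
apply: (@sub_finite_set _ _ ((Posz @` `I_N.+1) `|` (Negz @` `I_N.+1))); last first.
  by rewrite finite_setU; split; apply/finite_image/finite_II.
by move=> [m|m] /= mN; [left|right]; exists m => //=; lia.
Qed.

(** Dividing by a common bound [M] of the conjugates reduces the bounds
    of the two higher coefficients to [coarse_bounds]; the constant coefficient follows. *)
Lemma finite_cubic_int r :
  finite_set [set a | [/\ `|ceval l2 a| <= r, `|ceval l3 a| <= r & `|height a| <= r]].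
Proof.
pose M := Num.max r 1.
have [rM M1] : r <= M /\ 1 <= M by rewrite !le_max !lexx orbT.
have M0 : 0 < M by lra.
have [N MN] : exists N : nat, 9 * M <= N%:R.
  by exists (Num.bound (9 * M)); apply/ltW/archi_boundP; lra.
pose I := [set m : int | (`|m| <= N)%N].
apply: (@sub_finite_set _ _ ((I `*` I) `*` I)); last first.
  by do 2?[apply: finite_setX]; apply: finite_int_ball.
move=> [[a0 a1] a2] /= [h2 h3 h1].
have scale x : `|ceval x (a0, a1, a2)| <= r ->
    `|a0%:~R / M + (a1%:~R / M) * x + (a2%:~R / M) * x ^+ 2| <= 1.
  move=> h; have -> : a0%:~R / M + (a1%:~R / M) * x + (a2%:~R / M) * x ^+ 2 =
    ceval x (a0, a1, a2) / M by rewrite /=; ring.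
  by rewrite normrM normfV (gtr0_norm M0) ler_pdivrMr // mul1r (le_trans h).
have [k1 k2] : `|a1%:~R / M| <= 4 /\ `|a2%:~R / M| <= 4.
  apply: (coarse_bounds (lambda1_bounds R) (lambda2_bounds R) (lambda3_bounds R)).
  - have := lambda2_sq_bounds R; have := lambda3_sq_bounds R.
    by rewrite ler_norml; move: (l2 ^+ 2) (l3 ^+ 2); clear; move=> p q; lra.
  - by apply: (le_trans (scale _ h2)); clear; lra.
  - by apply: (le_trans (scale _ h3)); clear; lra.
  - by apply: (le_trans (scale _ h1)); clear; lra.
have [b1 b2] : `|a1%:~R : R| <= 4 * M /\ `|a2%:~R : R| <= 4 * M.
  by move: k1 k2; rewrite !normrM normfV (gtr0_norm M0) !ler_pdivrMr.
have b0 : `|a0%:~R : R| <= 9 * M.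
  have -> : a0%:~R = ceval l2 (a0, a1, a2) - (a1%:~R * l2 + a2%:~R * l2 ^+ 2).
    by rewrite /=; ring.
  apply: (le_trans (ler_normB _ _)).
  have h2' : `|ceval l2 (a0, a1, a2)| <= M := le_trans h2 rM.
  have q1 : `|a1%:~R * l2| <= 4 * M.
    rewrite normrM -[leRHS]mulr1 ler_pM //.
    by move: (lambda2_bounds R); rewrite ler_norml; move: l2; clear => x; lra.
  have q2 : `|a2%:~R * l2 ^+ 2| <= 4 * M.
    rewrite normrM -[leRHS]mulr1 ler_pM //.
    by move: (lambda2_sq_bounds R); rewrite ler_norml; move: (l2 ^+ 2); clear => x; lra.
  apply: (@le_trans _ _ (M + (4 * M + 4 * M))); last by clear -M0; lra.
  by apply: lerD => //; apply: (le_trans (ler_normD _ _)); apply: lerD.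
have toI (m : int) : `|m%:~R : R| <= 9 * M -> I m.
  by move=> /le_trans /(_ MN); rewrite /I /= -intr_norm -abszE -pmulrn ler_nat.
have M4 : 4 * M <= 9 * M by clear -M0; lra.
by split; [split|]; apply: toI => //; apply: le_trans M4.
Qed.

(** * One representative per coset of a rank one sublattice *)

(** The height of [x^2 - 1]. *)
Definition merged_length : R := l1 ^+ 2 - 1.

(** The window of the types [tL] and [tM], followed by the translate of the window
    of type [tS] by [2 lambda1^2 - 1]. *)
Definition merged_window (x : R) : bool := l1 - l1 ^+ 2 < x <= l1 - 1.

Definition coset_height (z : int * int) : R := z.1%:~R + z.2%:~R * l1.

(** The element of a coset with height in the merged window: the multiple of
    [x^2 - 1] to be added to [z.1 + z.2 x] is found by division. *)
Definition coset_index (z : int * int) : int :=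
  Num.floor ((l1 - 1 - coset_height z) / merged_length).

Definition coset_rep (z : int * int) : cubic_int :=
  (z.1 - coset_index z, z.2, coset_index z).

Lemma merged_length_gt0 : 0 < merged_length.
Proof.
rewrite /merged_length; move: (lambda1_sq_bounds R).
by move: (l1 ^+ 2); clear => x; lra.
Qed.

Lemma height_coset_rep z :
  height (coset_rep z) = coset_height z + (coset_index z)%:~R * merged_length.
Proof. by rewrite height_lit /coset_height /merged_length intrB; ring. Qed.

Lemma coset_rep_window z : merged_window (height (coset_rep z)).
Proof.
have w0 := merged_length_gt0; rewrite height_coset_rep /coset_index /merged_window.
set y := (_ / merged_length).
have /andP[f1 f2] : (Num.floor y)%:~R <= y < (Num.floor y + 1)%:~R.
  exact: floor_itv.
have yw : y * merged_length = l1 - 1 - coset_height z by rewrite /y divfK // gt_eqF.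
have wE : merged_length = l1 ^+ 2 - 1 by [].
rewrite intrD1 in f2.
by apply/andP; split; nra.
Qed.

(** A half-open interval of length [merged_length] contains exactly one point of
    each coset of the multiples of [merged_length]. *)
Lemma coset_rep_unique (a0 a1 a2 : int) : merged_window (height (a0, a1, a2)) ->
  coset_rep (a0 + a2, a1) = (a0, a1, a2).
Proof.
have w0 := merged_length_gt0 => /andP[lo up].
suff ia : coset_index (a0 + a2, a1) = a2 by rewrite /coset_rep ia /= addrK.
have hE : height (a0, a1, a2) = coset_height (a0 + a2, a1) + a2%:~R * merged_length.
  by rewrite height_lit /coset_height /merged_length intrD /=; ring.
apply/floor_def; rewrite ler_pdivlMr // ltr_pdivrMr // intrD1 mulrDl mul1r.
have wE : merged_length = l1 ^+ 2 - 1 by [].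
by rewrite hE in lo up; apply/andP; split; lra.
Qed.

(** The union of the windows of the three types. *)
Definition dual_window (x : R) : bool :=
  (l1 - l1 ^+ 2 < x <= 0) || (1 - 2 * l1 ^+ 2 < x <= l1 - 2 * l1 ^+ 2).

(** Undoes the translation that merges the windows. *)
Definition unmerge a : cubic_int := if height a <= 0 then a else a - (-1, 0, 2).

Lemma unmerge_window a : merged_window (height a) -> dual_window (height (unmerge a)).
Proof.
rewrite /merged_window /unmerge /dual_window; case: ifP => [a0|/negbT].
  by case/andP => -> _; rewrite a0.
rewrite -ltNge => a0 /andP[_ a1]; apply/orP; right.
rewrite heightD heightN height_lit; move: (height a) l1 a0 a1; clear => x y; lra.
Qed.

Lemma dual_windowP a : dual_window (height a) ->
  exists2 c, merged_window (height c) & unmerge c = a.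
Proof.
have l0 := l1_gt0 R.
have := lambda1_bounds R; have := lambda1_sq_bounds R.
case/andP=> s1 s2 /andP[b1 b2] /orP[] /andP[h1 h2].
  exists a; last by rewrite /unmerge h2.
  by rewrite /merged_window h1 /=; lra.
exists (a + (-1, 0, 2)); last first.
  rewrite /unmerge addrK ifF //; apply/negbTE; rewrite -ltNge heightD height_lit; lra.
rewrite /merged_window heightD height_lit; lra.
Qed.

Lemma unmerge_inj a c : merged_window (height a) -> merged_window (height c) ->
  unmerge a = unmerge c -> a = c.
Proof.
have := lambda1_bounds R; have := lambda1_sq_bounds R.
case/andP=> s1 s2 /andP[b1 b2] /andP[a1 a2] /andP[c1 c2].
have lt0 x y : merged_window (height x) -> merged_window (height y) ->
  0 < height x -> x - (-1, 0, 2) = y -> False.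
  move=> /andP[x1 x2] /andP[y1 y2] x0 xy; suff : (1 : R) < 0 by rewrite ltr10.
  by move: y1; rewrite -xy heightD heightN height_lit; lra.
rewrite /unmerge; case: ifP => [a0|/negbT]; case: ifP => [c0|/negbT] //;
  rewrite -?ltNge.
- by move=> c0 /esym/lt0[]; rewrite /merged_window ?c1 ?a1.
- by move=> a0 /lt0[]; rewrite /merged_window ?c1 ?a1.
- by move=> _ _ /addIr.
Qed.

End CosetRepresentatives.

(** * The density of the dual point set *)

Section DualPointDensity.
Variable R : realType.
Local Notation l1 := (lambda1 R).
Local Notation l2 := (lambda2 R).
Local Notation l3 := (lambda3 R).
Local Notation phys := (phys R).
Local Notation height := (height R).
Implicit Types (a c : cubic_int) (r : R).

Lemma dual_point_setE :
  dual_point_set R = [set phys a | a in [set a | dual_window (height a)]].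
Proof.
apply/seteqP; split => [p [k [t [k1 kp]]]|_ [a /= wa <-]].
  have [[t' a] [_ ->] wa] := window_of_generated kp.
  exists a => //; move: wa; rewrite /in_window /dual_window /= => {kp}.
  have := lambda1_bounds R; have := lambda1_sq_bounds R.
  move: (height a) l1; clear => x y.
  by case: t'; lra.
have [t wt] : exists t, in_window R (t, a).
  move: wa; rewrite /dual_window => /orP[/andP[h1 h2]|h]; last by exists tS.
  by have [h3|h3] := leP (height a) (- l1); [exists tM|exists tL]; apply: (introT andP).
have [k k1 kg] := (generatedP R (t, a)).2 wt.
by exists k, t; split.
Qed.

Definition parametrization (z : int * int) : 'rV[R]_2 :=
  phys (unmerge R (coset_rep R z)).

Lemma parametrization_inj : injective parametrization.
Proof.
move=> z z' /(@phys_inj R) /unmerge_inj e.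
have [] := e (coset_rep_window R z) (coset_rep_window R z').
case: z z' {e} => [m n] [m' n'] /= e1 nE kE.
by move: e1; rewrite kE => /addIr ->; rewrite nE.
Qed.

Lemma range_parametrization : dual_point_set R = range parametrization.
Proof.
rewrite dual_point_setE; apply/seteqP; split.
  move=> _ [a /= /dual_windowP[[[c0 c1] c2] wc <-] <-].
  by exists (c0 + c2, c1) => //; rewrite /parametrization coset_rep_unique.
move=> _ [z _ <-].
by exists (unmerge R (coset_rep R z)) => //; apply/unmerge_window/coset_rep_window.
Qed.

Lemma height_bounded a : dual_window (height a) -> `|height a| <= 16.
Proof.
have := lambda1_bounds R; have := lambda1_sq_bounds R.
rewrite ler_norml /dual_window; move: (height a) l1; clear => x y; lra.
Qed.

Lemma finite_dual_point_set r : finite_set (dual_point_set R `&` eball r).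
Proof.
have := @finite_cubic_int R (Num.max r 16); set I := mkset _ => finI.
apply: (@sub_finite_set _ _ (phys @` I)); last exact: finite_image.
rewrite dual_point_setE => _ [[a /= wa <-] ar]; exists a => //.
have n2 := le_trans (enorm_coord (phys a) 0) ar.
have n3 := le_trans (enorm_coord (phys a) 1) ar.
rewrite vec2_0 in n2; rewrite vec2_1 in n3.
by split; rewrite le_max ?n2 ?n3 ?height_bounded ?orbT.
Qed.

(** The multiple of [x^2 - 1] in the representative is
    [(height - z.1 - z.2 lambda1) / merged_length], which is affine in [z] up to
    the bounded contribution of the height. *)
Lemma phys_coset_rep (z : int * int) :
  phys (coset_rep R z) = (height (coset_rep R z) / merged_length R) *: phys (-1, 0, 1) +
   (z.1%:~R *: (phys (1, 0, 0) - (merged_length R)^-1 *: phys (-1, 0, 1)) +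
    z.2%:~R *: (phys (0, 1, 0) - (l1 / merged_length R) *: phys (-1, 0, 1))).
Proof.
have w0 : merged_length R != 0 by rewrite gt_eqF ?merged_length_gt0.
rewrite height_coset_rep /coset_height /coset_rep; set k := coset_index R z.
have E x : ceval x (z.1 - k, z.2, k) =
   (z.1%:~R + z.2%:~R * l1 + k%:~R * merged_length R) / merged_length R *
     ceval x (-1, 0, 1) +
   (z.1%:~R * (ceval x (1, 0, 0) - (merged_length R)^-1 * ceval x (-1, 0, 1))
   + z.2%:~R * (ceval x (0, 1, 0) - (l1 / merged_length R) * ceval x (-1, 0, 1))).
  by rewrite /= intrB; field.
by apply/rowP => i; rewrite !mxE; case: ifP => _; apply: E.
Qed.

Lemma parametrization_near : exists v v' : 'rV[R]_2, exists C : R,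
  forall z, enorm (parametrization z - (z.1%:~R *: v + z.2%:~R *: v')) <= C.
Proof.
have w0 := merged_length_gt0 R.
pose v : 'rV[R]_2 := phys (1, 0, 0) - (merged_length R)^-1 *: phys (-1, 0, 1).
pose v' : 'rV[R]_2 := phys (0, 1, 0) - (l1 / merged_length R) *: phys (-1, 0, 1).
pose D := 10 / merged_length R * enorm (phys (-1, 0, 1)).
exists v, v', (D + enorm (phys (-1, 0, 2))) => z.
have n1 : enorm (phys (coset_rep R z) - (z.1%:~R *: v + z.2%:~R *: v')) <= D.
  rewrite phys_coset_rep addrK.
  set h := height _; have hb : `|h| <= 10.
    have := coset_rep_window R z; rewrite -/h /merged_window ler_norml.
    have := lambda1_bounds R; have := lambda1_sq_bounds R.
    by move: h l1; clear => x y; lra.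
  have enormZ' s (x : 'rV[R]_2) : enorm (s *: x) = `|s| * enorm x.
    have [s0|s0] := leP 0 s; first by rewrite enormZ // ger0_norm.
    by rewrite -enormN -scaleNr enormZ ?oppr_ge0 ?(ltW s0) // ltr0_norm.
  rewrite enormZ' normrM normfV (gtr0_norm w0).
  by rewrite ler_wpM2r ?enorm_ge0 // ler_wpM2r // invr_ge0 ltW.
rewrite /parametrization /unmerge; case: ifP => _.
  by apply: (le_trans n1); rewrite lerDl enorm_ge0.
rewrite physB addrAC; apply: (le_trans (enormD _ _)); rewrite enormN.
by apply: lerD => //; exact: n1.
Qed.

Lemma ball_count_dual_point_set :
  exists L : R, (ball_count (dual_point_set R) r)%:R / r ^+ 2 @[r --> +oo%R] --> L.
Proof.
have [v [v' [C vC]]] := parametrization_near.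
apply: ball_count_near_lattice vC; first exact: finite_dual_point_set.
  exact: parametrization_inj.
exact: range_parametrization.
Qed.

End DualPointDensity.

(** * Windows on the line *)

Section Window.
Variable R : realType.

(** Points are degenerate boxes. *)
Lemma lebesgue_sub_finite (A : set 'rV[R]_1) (s : seq 'rV[R]_1) :
  A `<=` [set` s] -> lebesgue A = 0%E.
Proof.
move=> As; apply/eqP; rewrite eq_le; apply/andP; split; last first.
  apply/ereal_infP => _ [a [b [ab _ ->]]].
  apply: nneseries_ge0 => k _ _.
  by rewrite lee_fin prodr_ge0 // => i _; rewrite subr_ge0.
apply: ge_ereal_inf; exists 0%E => //.
exists (nth 0 s), (nth 0 s); split => //.
  by move=> x /As /= /(nthP 0)[k _ <-]; exists k => // i; rewrite lexx.
by rewrite eseries0 // => k _ _; rewrite big_ord1 subrr.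
Qed.

Lemma rV1_ballE (x y : 'rV[R]_1) e : 0 < e -> `|x 0 0 - y 0 0| < e -> ball x e y.
Proof. by move=> e0 xy; split=> // i j; rewrite !ord1. Qed.

Definition coord_set (A : set R) : set 'rV[R]_1 := [set x | A (x 0 0)].

Lemma window_coord_set (p q r s : R) : p < q -> r < s ->
  window (coord_set (`[p, q] `|` `[r, s])).
Proof.
move=> pq rs; set A := _ `|` _.
pose O : set R := `]p, q[ `|` `]r, s[.
have OI : coord_set O `<=` interior (coord_set A).
  rewrite -open_subsetE.
    move=> x [|] /=; rewrite in_itv /= => /andP[h1 h2]; [left|right];
      by rewrite /= in_itv /= (ltW h1) (ltW h2).
  apply: open_comp; first by move=> x _; apply: coord_continuous.
  by apply: openU; apply: interval_open.
have clA : closed (coord_set A).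
  apply: preimage_closed; first by move=> x _; apply: coord_continuous.
  by apply: closedU; apply: itv_closed.
(* move from [t] towards the midpoint of the interval *)
have approach l h t e : l < h -> l <= t <= h -> 0 < e ->
    exists2 z : R, l < z < h & `|t - z| < e.
  move=> lh /andP[lt th] e0.
  pose d := e / (e + (h - l)).
  have D0 : 0 < e + (h - l) by lra.
  have dE : d * (e + (h - l)) = e by rewrite /d divfK // gt_eqF.
  have d0 : 0 < d by rewrite divr_gt0.
  have d1 : d < 1 by rewrite ltr_pdivrMr // mul1r; lra.
  exists (t + d * ((l + h) / 2 - t)); first by apply/andP; split; nra.
  by rewrite ltr_norml; apply/andP; split; nra.
split.
- by exists (const_mx p); left; rewrite /= mxE in_itv /= lexx ltW.
- have -> : coord_set A = [set v : 'rV[R]_1 | forall i, A (v ord0 i)].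
    apply/seteqP; split=> [v Av i|v Av]; last exact: (Av ord0).
    by have -> : i = ord0 by apply: ord1.
  by apply: (@rV_compact _ _ (fun=> A)) => _; apply: compactU; apply: segment_compact.
- apply/seteqP; split.
    rewrite [X in _ `<=` X](closure_id _).1 //; apply: closureS; exact: interior_subset.
  apply: (@subset_trans _ (closure (coord_set O))); last exact: closureS.
  move=> x Ax B /nbhs_ballP[e /= e0 eB].
  have [z Oz xz] : exists2 z, O z & `|x 0 0 - z| < e.
    case: Ax => /=; rewrite in_itv /= => xI.
      have [z zI xz] := approach _ _ _ _ pq xI e0.
      by exists z => //; left; rewrite /= in_itv.
    have [z zI xz] := approach _ _ _ _ rs xI e0.
    by exists z => //; right; rewrite /= in_itv.
  exists (const_mx z); split; first by rewrite /coord_set /= mxE.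
  by apply: eB; apply: rV1_ballE => //; rewrite mxE.
- apply: (@lebesgue_sub_finite _ [:: const_mx p; const_mx q; const_mx r; const_mx s]).
  rewrite /boundary -(closure_id _).1 // => x [Ax nI].
  have xE : x = const_mx (x 0 0) by apply/rowP => i; rewrite mxE ord1.
  have nO : ~ O (x 0 0) by move=> Ox; apply/nI/OI.
  have At : A (x 0 0) by exact: Ax.
  rewrite /= xE; move: (x 0 0) nO At {Ax xE nI} => t nO At.
  suff : [|| t == p, t == q, t == r | t == s].
    by case/or4P => /eqP ->; rewrite !inE eqxx ?orbT.
  move: At nO; rewrite /A /O /= !in_itv /= => -[] /andP[h1 h2] nO.
    move: h1 h2; rewrite !le_eqVlt => /orP[/eqP ->|h1]; first by rewrite eqxx.
    by case/orP=> [/eqP ->|h2]; [rewrite eqxx orbT|case: nO; left; rewrite h1].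
  move: h1 h2; rewrite !le_eqVlt => /orP[/eqP ->|h1]; first by rewrite eqxx !orbT.
  by case/orP=> [/eqP ->|h2]; [rewrite eqxx !orbT|case: nO; right; rewrite h1].
Qed.

End Window.

(** * The cut-and-project scheme *)

Section Lattice.
Variable R : realType.
Local Notation l1 := (lambda1 R).
Local Notation l2 := (lambda2 R).
Local Notation l3 := (lambda3 R).
Local Notation phys := (phys R).
Local Notation height := (height R).
Implicit Types (a c : cubic_int).

Definition lattice_point a : 'rV[R]_(2 + 1) := row_mx (phys a) (const_mx (height a)).

Lemma proj1_lattice_point a : proj1 (lattice_point a) = phys a.
Proof. exact: row_mxKl. Qed.

Lemma proj2_lattice_point a : proj2 (lattice_point a) = const_mx (height a).
Proof. exact: row_mxKr. Qed.

Definition conjugates : 'rV[R]_3 :=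
  \row_j (if j == 0 then l2 else if j == 1 then l3 else l1).

(** The images of [1], [x], [x^2] are the rows of a Vandermonde matrix. *)
Lemma full_rank_lattice_points : full_rank_lattice (range lattice_point).
Proof.
exists (Vandermonde 3 conjugates : 'M[R]_(2 + 1)).
  rewrite unitmxE det_Vandermonde unitfE.
  apply/prodf_neq0 => i _; apply/prodf_neq0 => j ij; rewrite !mxE subr_eq0.
  have := lambda1_bounds R; have := lambda2_bounds R; have := lambda3_bounds R.
  move: l1 l2 l3 => x y z /andP[? ?] /andP[? ?] /andP[? ?].
  case: i j ij => [[|[|[|//]]] ilt] [[|[|[|//]]] jlt] //= _; rewrite gt_eqF //; lra.
have E (z : 'rV[int]_3) : map_mx intr z *m (Vandermonde 3 conjugates : 'M[R]_(2 + 1)) =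
    lattice_point (z 0 0, z 0 1, z 0 2).
  apply/rowP => j; rewrite !mxE !big_ord_recl big_ord0 !mxE.
  have -> : lift ord0 ord0 = 1 :> 'I_3 by apply: val_inj.
  have -> : lift ord0 (lift ord0 ord0) = 2 :> 'I_3 by apply: val_inj.

  case: (splitP j) => i ji; rewrite !mxE.
    have -> : j = lshift 1 i by apply: val_inj.
    by case: i ji => [[|[|//]] ilt] /= ji; rewrite /= ?expr0 ?expr1; ring.
  have -> : j = 2 by apply: val_inj; rewrite /= ji ord1.
  by rewrite height_lit /=; ring.
apply/seteqP; split => [_ [[[a0 a1] a2] _ <-]|_ [z _ <-]].
  exists (\row_j (if j == 0 then a0 else if j == 1 then a1 else a2)) => //.
  by rewrite E !mxE.
by rewrite E; exists (z 0 0, z 0 1, z 0 2).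
Qed.

Lemma proj1_inj_lattice_points : set_inj (range lattice_point) (@proj1 R 2 1).
Proof.
move=> x y; rewrite !inE => -[a _ <-] [c _ <-].
by rewrite !proj1_lattice_point => /(@phys_inj R) ->.
Qed.

(** Powers of [1 / lambda1] are heights of cubic integers and tend to 0, so the
    multiples of one of them form an arbitrarily fine net. *)
Lemma height_dense (x e : R) : 0 < e -> exists a, `|x - height a| < e.
Proof.
move=> e0; have l0 := l1_gt0 R.
have hn n : height (iter n div_root (1, 0, 0)) = l1 ^- n.
  elim: n => [|n IHn]; first by rewrite height_lit expr0 invr1 /=; ring.
  apply: (mulfI (lt0r_neq0 l0)).
  rewrite iterS -height_mul_root div_rootK IHn exprS invfM mulrA divff ?mul1r //.
  by rewrite gt_eqF.
have [n ne] : exists n, l1 ^- n < e.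
  exists (Num.bound e^-1); set n := Num.bound _.
  have h : e^-1 < 2 ^+ n := @upper_nthrootP R e^-1 _ (leqnn _).
  rewrite invf_plt ?posrE ?exprn_gt0 //; apply: lt_le_trans h _.
  apply: lerXn2r; rewrite ?nnegrE ?(ltW l0) //.
  by have /andP[h _] := lambda1_bounds R; lra.
have d0 : 0 < l1 ^- n by rewrite invr_gt0 exprn_gt0.
move: (iter n _ _) (hn n) => [[a0 a1] a2] h.
pose m := Num.floor (x / l1 ^- n).
exists (m * a0, m * a1, m * a2).
have -> : height (m * a0, m * a1, m * a2) = m%:~R * l1 ^- n.
  by rewrite -h !height_lit !intrM; ring.
have /andP[f1 f2] := floor_itv (x / l1 ^- n).
rewrite -/m ler_pdivlMr // in f1; rewrite -/m ltr_pdivrMr // intrD1 in f2.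
by rewrite ltr_norml; apply/andP; split; lra.
Qed.

Lemma dense_lattice_heights : dense (@proj2 R 2 1 @` range lattice_point).
Proof.
move=> O [x Ox] openO.
have /nbhs_ballP[e /= e0 eO] : nbhs x O by apply: open_nbhs_nbhs.
have [a ha] := height_dense (x 0 0) e0.
exists (const_mx (height a)); split.
  by apply: eO; apply: rV1_ballE => //; rewrite mxE.
by exists (lattice_point a); [exists a|rewrite proj2_lattice_point].
Qed.

Definition closed_window : set R :=
  `[l1 - l1 ^+ 2, 0] `|` `[1 - 2 * l1 ^+ 2, l1 - 2 * l1 ^+ 2].

(** The two exceptional cubic integers are those whose heights are the open ends
    of the components of the half-open window. *)
Lemma closed_windowP a : closed_window (height a) <->
  [\/ dual_window (height a), a = (0, 1, -1) | a = (1, 0, -2)].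
Proof.
have h1 : height (0, 1, -1) = l1 - l1 ^+ 2 by rewrite height_lit; ring.
have h2 : height (1, 0, -2) = 1 - 2 * l1 ^+ 2 by rewrite height_lit; ring.
have height_inj := ceval_inj (lambda1_root R).
rewrite /closed_window /dual_window; split.
  case; rewrite /= in_itv /= le_eqVlt => /andP[/orP[/eqP lo|lo] up].
  - by constructor 2; apply: height_inj; rewrite -/(height a) -lo -h1.
  - by constructor 1; rewrite lo up.
  - by constructor 3; apply: height_inj; rewrite -/(height a) -lo -h2.
  - by constructor 1; rewrite lo up orbT.
case=> [/orP[]/andP[lo up]|->|->].
- by left; rewrite /= in_itv /= (ltW lo) up.
- by right; rewrite /= in_itv /= (ltW lo) up.
- left; rewrite h1 /= in_itv /= lexx /=.
  have := lambda1_bounds R; have := lambda1_sq_bounds R; lra.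
- right; rewrite h2 /= in_itv /= lexx /=.
  have := lambda1_bounds R; lra.
Qed.

Lemma cut_and_project_lattice_points :
  cut_and_project_set (range lattice_point) (coord_set closed_window) =
  dual_point_set R `|` [set phys (0, 1, -1); phys (1, 0, -2)].
Proof.
have mem a :
  coord_set closed_window (proj2 (lattice_point a)) = closed_window (height a).
  by rewrite proj2_lattice_point /coord_set /= mxE.
rewrite dual_point_setE; apply/seteqP; split => [_ [x [[a _ <-] ax] <-]|p].
  move: ax; rewrite proj1_lattice_point mem => /closed_windowP[wa|->|->].
  - by left; exists a.
  - by right; left.
  - by right; right.
have proj a : closed_window (height a) ->
    cut_and_project_set (range lattice_point) (coord_set closed_window) (phys a).
  move=> wa; exists (lattice_point a); last exact: proj1_lattice_point.
  by split; [exists a|rewrite mem].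
case=> [[a wa <-]|[->|->]]; apply/proj/closed_windowP.
- by constructor 1.
- by constructor 2.
- by constructor 3.
Qed.

End Lattice.

Theorem theorem2p1 (R : realType) : regular_model_set (dual_point_set R).
Proof.
have Yfin : finite_set [set phys R (0, 1, -1); phys R (1, 0, -2)].
  by rewrite finite_setU; split; apply: finite_set1.
exists 1, (range (@lattice_point R)), (coord_set (@closed_window R)); split => //.
- split; first exact: full_rank_lattice_points.
    exact: proj1_inj_lattice_points.
  exact: dense_lattice_heights.
- have := lambda1_bounds R; have := lambda1_sq_bounds R.
  by move=> *; apply: window_coord_set; lra.
- by rewrite cut_and_project_lattice_points; left.
have [L cL] := ball_count_dual_point_set R.
have Vfin := @finite_dual_point_set R.
exists (L / fine (lebesgue (@eball R 2 1))); split.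
  exact: has_density_of_ball_count.
rewrite cut_and_project_lattice_points.
apply: has_density_of_ball_count; last exact: cvg_ball_count_setU.
by move=> r; rewrite setIUl finite_setU; split=> //; apply: finite_setIl.
Qed.
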